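(* Let $W=TT^*$ on $\mathbb{R}$ with $T'=GT$, $G$ a matrix polynomial, as in the context; write $\mathcal{A}_n(z)=\mathcal{A}_n(z;G)$, $\mathcal{B}_n(z)=\mathcal{B}_n(z;G)$. Let $n\ge0$ and suppose that the inverse of $\mathcal{A}_n(z;G)$ exists for $z\in\mathbb{C}$. Then $$\widehat P_n''+2\widehat P_n'G+\widehat P_n\big(G'+G^2\big)+\mathcal{M}_n\widehat P_n'+\mathcal{N}_n\widehat P_n+\mathcal{M}_n\widehat P_nG=0,$$ where $$\mathcal{M}_n(z)=-(\mathcal{A}_n^*(z))'\mathcal{A}_n^{-*}(z)+\mathcal{B}_n(z)-\mathcal{A}_n^*(z)(zI_N-\alpha_n)+\mathcal{A}_n^*(z)\mathcal{B}_{n+1}(z)\mathcal{A}_n^{-*}(z),$$ $$\mathcal{N}_n(z)=\mathcal{M}_n(z)\mathcal{B}_n(z)-\mathcal{B}_n^2(z)+\mathcal{B}_n'(z)+\mathcal{A}_n^*(z)\beta_n\mathcal{A}_{n-1}^*(z).$$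
   Context: Fix $N\ge1$. The weight $W:\mathbb{R}\to GL(N,\mathbb{R})$ is smooth, $W(x)$ is (symmetric) positive definite for every $x\in\mathbb{R}$, and all entries of $W$ and $W'$ have finite moments of all orders on $\mathbb{R}$. $A^*$ is the conjugate transpose; for matrix functions of a complex variable $F^*(z):=(F(\bar z))^*$ and $F^{-*}(z):=(F^*(z))^{-1}$. It is assumed that $W(x)=T(x)T^*(x)$ for $x\in\mathbb{R}$, where $T$ is a smooth $N\times N$ matrix-valued function satisfying $T'=GT$ with a matrix polynomial $G$; hence $T$ extends to an entire, everywhere invertible matrix function satisfying $T'(z)=G(z)T(z)$ on $\mathbb{C}$. $\widehat P_n(x)=x^nI_N+\sum_{j=0}^{n-1}a_{n,j}x^j$ is the monic matrix polynomial of degree $n$ with $\int_{\mathbb{R}}\widehat P_n W Q^*dx=0$ for all matrix polynomials $Q$ of degree $\le n-1$; $a_{n,n}=I_N$ and $a_{n,j}=0$ for $j<0$ or $j>n$. $\gamma_n=\big(\int_{\mathbb{R}}\widehat P_nW\widehat P_n^*dx\big)^{-1}$. $b_{n,k}=\int_{\mathbb{R}}x^k\widehat P_n(x)W(x)dx$ for $k\ge n$, and $b_{n,k}=0$ for $k<n$. $\alpha_n=a_{n,n-1}-a_{n+1,n}$, $\beta_n=\gamma_n^{-1}\gamma_{n-1}$ ($n\ge1$) are the coefficients of the recurrence $x\widehat P_n=\widehat P_{n+1}+\alpha_n\widehat P_n+\beta_n\widehat P_{n-1}$; $\beta_0=0$, $\widehat P_{-1}=0$. For any matrix polynomial $K(z)=\sum_{j=0}^mM_jz^j$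 define $\widehat P_{n,k}(z)=z^kI_N+a_{n,n-1}z^{k-1}+\cdots+a_{n,n-k}$, $\Delta_{j,n}(z)=\sum_{k=0}^j\widehat P_{n,k}(z)M_{m-j+k}$, $$\mathcal{A}_n(z;K)=-\gamma_n\sum_{j=0}^{m-1}\big(b_{n,n+m-j-1}\Delta_{j,n}^*(z)+\Delta_{j,n}(z)b_{n,n+m-j-1}^*\big),$$ $$\mathcal{B}_n(z;K)=-\sum_{j=0}^{m}\big(\Delta_{j,n}(z)b_{n-1,n+m-j-1}^*+b_{n,n+m-j-2}\Delta_{j,n-1}^*(z)\big)\gamma_{n-1}\quad(n\ge1),$$ with the conventions $\mathcal{B}_0(z;K):=-K(z)$ and $\mathcal{A}_{-1}(z;K):=0$. *)

(* Defs.v *)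
From HB Require Import structures.
From mathcomp Require Import all_boot all_order all_algebra.
From mathcomp Require Import complex.
From mathcomp Require Import all_classical all_reals all_analysis.

Set Implicit Arguments.
Unset Strict Implicit.
Unset Printing Implicit Defensive.

Import Order.TTheory GRing.Theory Num.Theory.
Import numFieldNormedType.Exports.

Local Open Scope classical_set_scope.
Local Open Scope ring_scope.
Local Open Scope complex_scope.
Local Open Scope sesquilinear_scope.

(* Throughout, the matrix size is N.+1, so that square matrices form a
   nontrivial ring and matrix polynomials are {poly 'M[R[i]]_N.+1}, with
   matrix coefficients written on the left of the (central) variable. *)

Section Weights.
Context {R : realType}.

Definition smooth (f : R -> R) : Prop :=
  forall (k : nat) (x : R), derivable (derive1n k f) x 1.

Definition posdefmx (n : nat) (A : 'M[R]_n) : Prop :=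
  A^T = A /\ forall v : 'rV[R]_n, v != 0 -> 0 < (v *m A *m v^T) 0 0.

Definition finite_moments (f : R -> R) : Prop :=
  forall k : nat,
    (@lebesgue_measure R).-integrable setT (fun x => (x ^+ k * f x)%:E).

Definition is_weight (N : nat) (W : R -> 'M[R]_N.+1) : Prop :=
  [/\ forall i j, smooth (fun x => W x i j),
      forall x, posdefmx (W x),
      forall i j, finite_moments (fun x => W x i j)
    & forall i j, finite_moments (derive1 (fun x => W x i j))].

Definition cintegral (f : R -> R[i]) : R[i] :=
  (\int[@lebesgue_measure R]_(x in setT) complex.Re (f x))
  +i* (\int[@lebesgue_measure R]_(x in setT) complex.Im (f x)).

Definition mxintegral (m n : nat) (F : R -> 'M[R[i]]_(m, n)) : 'M[R[i]]_(m, n) :=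
  \matrix_(i, j) cintegral (fun x => F x i j).

End Weights.

Section MatrixPolynomials.
Context {R : realType} {N : nat}.
Local Notation M := 'M[R[i]]_N.+1.
Implicit Types (p K : {poly M}) (z : R[i]).

Definition mxeval p z : M := p.[z%:M].

Definition mxpoly_star p : {poly M} := map_poly (fun A : M => A ^t*) p.

Lemma mxeval_star p z : mxeval (mxpoly_star p) z = (mxeval p (Num.conj z)) ^t*.
Proof.
have adjD (A B : M) : (A + B) ^t* = A ^t* + B ^t*.
  by rewrite linearD /= map_mxD.
have adj0 : (0 : M) ^t* = 0 by rewrite trmx0 map_mx0.
have scX (y : R[i]) k : (y%:M : M) ^+ k = (y ^+ k)%:M by rewrite -rmorphXn.
rewrite /mxeval /mxpoly_star map_polyE.
have -> : (Poly [seq A ^t* | A <- p : seq M]).[z%:M]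
        = \sum_(i < size p) (p`_i ^t* : M) * (z%:M) ^+ i.
  rewrite horner_Poly.
  elim: {p}(p : seq M) => [|a s IH] /=; first by rewrite big_ord0.
  rewrite IH big_ord_recl /= expr0 mulr1 addrC; congr (_ + _).
  rewrite mulr_suml; apply: eq_bigr => i _.
  by rewrite /bump /= add1n exprSr mulrA.
rewrite horner_coef (big_morph (fun A : M => A ^t*) adjD adj0); apply: eq_bigr => i _.
rewrite !scX.
rewrite -[_ * _]/(_ *m _) -[X in _ = X ^t*]/(_ *m _) !mul_mx_scalar.
by apply/matrixP => k l; rewrite !mxE rmorphM /= -rmorphXn /= conjCK.
Qed.

Definition real_mxeval p (x : R) : M := mxeval p x%:C.

(* The derivative of T is taken entrywise, on real and imaginary parts. *)
Definition mx_ode_solution (T : R -> M) (G : {poly M}) : Prop :=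
  forall (x : R) i j,
    derive1 (fun t => complex.Re (T t i j)) x = complex.Re ((real_mxeval G x *m T x) i j) /\
    derive1 (fun t => complex.Im (T t i j)) x = complex.Im ((real_mxeval G x *m T x) i j).

Definition mx_smooth (T : R -> M) : Prop :=
  forall i j, smooth (fun x => complex.Re (T x i j)) /\ smooth (fun x => complex.Im (T x i j)).

End MatrixPolynomials.

Section OrthogonalPolynomials.
Context {R : realType} {N : nat}.
Local Notation M := 'M[R[i]]_N.+1.
Implicit Types (W : R -> 'M[R]_N.+1) (P : nat -> {poly M}) (K : {poly M}).

Definition cweight W (x : R) : M := map_mx (real_complex R) (W x).

Definition mxinner W (p q : {poly M}) : M :=
  mxintegral (fun x => real_mxeval p x *m cweight W x *m (real_mxeval q x) ^t*).

Definition monic_orthogonal W P : Prop :=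
  forall n : nat,
    [/\ P n \is monic, size (P n) = n.+1
      & forall Q : {poly M}, (size Q <= n)%N -> mxinner W (P n) Q = 0].

(* a_{n,j} *)
Definition acoef P (n : nat) (j : int) : M :=
  match j with Posz k => (P n)`_k | Negz _ => 0 end.

(* b_{n,k} *)
Definition bcoef W P (n k : nat) : M :=
  if (n <= k)%N
  then mxintegral (fun x => (x ^+ k)%:C *: (real_mxeval (P n) x *m cweight W x))
  else 0.

Definition gamma_mx W P (n : nat) : M := invmx (mxinner W (P n) (P n)).

Definition alpha_mx P (n : nat) : M :=
  acoef P n (n%:Z - 1) - acoef P n.+1 n%:Z.

Definition beta_mx W P (n : nat) : M :=
  if n is n'.+1 then invmx (gamma_mx W P n) *m gamma_mx W P n' else 0.

(* \hat P_{n,k}(z) *)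
Definition Ptrunc P (n k : nat) : {poly M} :=
  \sum_(i < k.+1) (acoef P n (n%:Z - i%:Z))%:P * 'X^(k - i).

(* K(z) = \sum_(j <= m) M_j z^j with m = deg_mx K; a larger m would only add
   vanishing terms to the sums below. *)
Definition deg_mx K : nat := (size K).-1.

Definition Delta P K (j n : nat) : {poly M} :=
  \sum_(k < j.+1) Ptrunc P n k * (K`_(deg_mx K - j + k))%:P.

Definition calA W P K (n : nat) : {poly M} :=
  let m := deg_mx K in
  - ((gamma_mx W P n)%:P *
     \sum_(j < m)
       ((bcoef W P n (n + m - j - 1))%:P * mxpoly_star (Delta P K j n)
        + Delta P K j n * ((bcoef W P n (n + m - j - 1)) ^t* : M)%:P)).

(* \mathcal{A}_{n-1}, with \mathcal{A}_{-1} = 0 *)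
Definition calA_pred W P K (n : nat) : {poly M} :=
  if n is n'.+1 then calA W P K n' else 0.

(* The only negative index in the formula is n + m - j - 2 = -1, at n = 1 and
   j = m: natural subtraction makes it 0, and b_{1,0} = 0 = b_{1,-1}. *)
Definition calB W P K (n : nat) : {poly M} :=
  if n is n'.+1 then
    let m := deg_mx K in
    - ((\sum_(j < m.+1)
          (Delta P K j n * ((bcoef W P n' (n + m - j - 1)) ^t* : M)%:P
           + (bcoef W P n (n + m - j - 2))%:P * mxpoly_star (Delta P K j n')))
       * (gamma_mx W P n')%:P)
  else - K.

(* F^{-*}(z) *)
Definition inv_star (F : {poly M}) (z : R[i]) : M :=
  invmx (mxeval (mxpoly_star F) z).

Definition calM W P G (n : nat) (z : R[i]) : M :=
  let As := mxpoly_star (calA W P G n) in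
  - (mxeval As^`() z *m inv_star (calA W P G n) z)
  + mxeval (calB W P G n) z
  - mxeval As z *m (z%:M - alpha_mx P n)
  + mxeval As z *m mxeval (calB W P G n.+1) z *m inv_star (calA W P G n) z.

Definition calN W P G (n : nat) (z : R[i]) : M :=
  let As := mxpoly_star (calA W P G n) in
  let B := calB W P G n in
  calM W P G n z *m mxeval B z
  - mxeval B z *m mxeval B z
  + mxeval B^`() z
  + mxeval As z *m beta_mx W P n *m mxeval (mxpoly_star (calA_pred W P G n)) z.

End OrthogonalPolynomials.

(* Main.v *)
(* Write D p = p' + p G, and for polynomials p, q let
   Phi_z(p, q) = \int p (H_z W + W H_{\bar z}^* ) q^* with H_z(x) the divided
   difference (G(x) - G(z)) / (x - z).  Since W' = G W + W G^*, integrating by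
   parts and using the Christoffel-Darboux formula gives the lowering relation
   D P_n = A_n^* beta_n P_{n-1} - B_n P_n, where A_n^* = - Phi(P_n, P_n) gamma_n
   and B_n = - (Phi(P_n, P_{n-1}) gamma_{n-1} + G); expanding P_n G in powers of z
   identifies these with the explicit sums over Delta_{j,n}.  The recurrence
   relation inside Phi yields the compatibility relation
   B_{n+2} - (z - alpha_{n+1}) A_{n+1}^*
     = beta_{n+1} (B_n - A_n^* (z - alpha_n)) beta_{n+1}^{-1},
   and eliminating P_{n-1} from D (D P_n) gives the differential equation.
   Since A_n = - gamma_n Phi(P_n, P_n), invertibility of A_n(z) and of A_n^*(z)
   are equivalent. *)

Require Import Defs.
From mathcomp Require Import all_boot all_order all_algebra.
From mathcomp Require Import complex.
From mathcomp Require Import all_classical all_reals all_analysis.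
From mathcomp Require Import zify ring.

Import Order.TTheory GRing.Theory Num.Theory.
Import numFieldNormedType.Exports.

Local Open Scope ring_scope.
Local Open Scope complex_scope.
Local Open Scope sesquilinear_scope.

Set Implicit Arguments.
Unset Strict Implicit.

(** * Matrix polynomials *)

Section StarMatrix.
Context {R : realType} {N : nat}.
Local Notation M := 'M[R[i]]_N.+1.
Implicit Types (A B : M) (p q F : {poly M}) (z : R[i]).

Definition adj A : M := A ^t*.

Lemma adjD A B : adj (A + B) = adj A + adj B.
Proof. by rewrite /adj linearD /= map_mxD. Qed.

Lemma adj0 : adj 0 = 0.
Proof. by rewrite /adj trmx0 map_mx0. Qed.

Lemma adjN A : adj (- A) = - adj A.
Proof. by rewrite /adj linearN /= map_mxN. Qed.

Lemma adjM A B : adj (A * B) = adj B * adj A.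
Proof. by rewrite /adj -[A * B]/(A *m B) trmx_mul map_mxM. Qed.

Lemma adjK A : adj (adj A) = A.
Proof. by apply/matrixP => i j; rewrite !mxE conjCK. Qed.

Lemma adj_scalar z : adj z%:M = (Num.conj z)%:M.
Proof. by rewrite /adj tr_scalar_mx map_scalar_mx. Qed.

Lemma adj1 : adj 1 = 1.
Proof. by rewrite /adj trmx1 map_mx1. Qed.

Lemma adj_sum I (r : seq I) (Q : pred I) (F : I -> M) :
  adj (\sum_(i <- r | Q i) F i) = \sum_(i <- r | Q i) adj (F i).
Proof. exact: (big_morph adj adjD adj0). Qed.

Lemma adjV A : A \is a GRing.unit -> adj A^-1 = (adj A)^-1.
Proof.
move=> uA; have h : adj A^-1 * adj A = 1 by rewrite -adjM divrr// adj1.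
have h' : adj A * adj A^-1 = 1 by rewrite -adjM mulVr// adj1.
have u : adj A \is a GRing.unit by apply/unitrP; exists (adj A^-1).
by apply: (mulIr u); rewrite h mulVr.
Qed.

Lemma scalar_comm z A : z%:M * A = A * z%:M.
Proof. exact: comm_scalar_mx. Qed.

(** Scalar matrices commute with every coefficient, which makes evaluation at [z%:M] multiplicative
    over the noncommutative coefficient ring. *)
Lemma comm_poly_scalar p z : comm_poly p (z%:M : M).
Proof. by apply: comm_coef_poly => i; rewrite /GRing.comm scalar_comm. Qed.

Lemma mxevalD p q z : mxeval (p + q) z = mxeval p z + mxeval q z.
Proof. exact: hornerD. Qed.

Lemma mxevalN p z : mxeval (- p) z = - mxeval p z.
Proof. exact: hornerN. Qed.

Lemma mxevalM p q z : mxeval (p * q) z = mxeval p z * mxeval q z.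
Proof. exact/hornerM_comm/comm_poly_scalar. Qed.

Lemma mxevalC A z : mxeval A%:P z = A.
Proof. exact: hornerC. Qed.

Lemma mxevalX z : mxeval 'X z = z%:M :> M.
Proof. exact: hornerX. Qed.

Lemma mxeval0 z : mxeval 0 z = 0 :> M.
Proof. exact: horner0. Qed.

Lemma mxeval_sum I (r : seq I) (Q : pred I) (F : I -> {poly M}) z :
  mxeval (\sum_(i <- r | Q i) F i) z = \sum_(i <- r | Q i) mxeval (F i) z.
Proof.
apply: (big_morph (fun p => mxeval p z)) => [p q|]; first exact: mxevalD.
exact: mxeval0.
Qed.

Lemma mxeval_coef_entry p z i j :
  mxeval p z i j = (\poly_(k < size p) (p`_k i j)).[z].
Proof.
rewrite /mxeval horner_coef summxE horner_poly; apply: eq_bigr => k _.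
by rewrite -rmorphXn /= -[_ * _]/(_ *m _) mul_mx_scalar mxE mulrC.
Qed.

(** Each entry of a value is a complex polynomial in z, hence determined by its values. This turns
    relations proved pointwise into polynomial identities, which can be differentiated. *)
Lemma mxeval_inj p q : (forall z, mxeval p z = mxeval q z) -> p = q.
Proof.
move=> h; apply/eqP; rewrite -subr_eq0; apply/eqP.
set r := p - q; have r0 z : mxeval r z = 0 by rewrite mxevalD mxevalN h subrr.
have entry0 i j : \poly_(k < size r) (r`_k i j) = 0.
  set s := \poly_(k < _) _.
  (* In characteristic zero the naturals below [size s] are distinct roots, too many for a nonzero
     s. *)
  apply: (@roots_geq_poly_eq0 _ s [seq k%:R | k <- iota 0 (size s)]).
  - by apply/allP => _ /mapP[k _ ->]; rewrite /root -mxeval_coef_entry r0 mxE.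
  - by rewrite map_inj_uniq ?iota_uniq //; exact: mulrIn (oner_neq0 _).
  - by rewrite size_map size_iota.
apply/polyP => k; rewrite coef0; apply/matrixP => i j; rewrite mxE.
have := congr1 (fun s : {poly R[i]} => s`_k) (entry0 i j).
rewrite coef_poly coef0; case: ltnP => // hk _.
by rewrite nth_default// mxE.
Qed.

(** The divided difference (F(x) - F(z)) / (x - z), by synthetic division: the coefficient of x^i is
    the value at z of F with its first i + 1 coefficients removed and the rest shifted down. *)
Definition divdiff F z : {poly M} :=
  \poly_(i < size F) mxeval (drop_poly i.+1 F) z.

Lemma coef_divdiff F z i : (divdiff F z)`_i = mxeval (drop_poly i.+1 F) z.
Proof.
rewrite coef_poly; case: ltnP => // h; rewrite drop_poly_eq0 ?mxeval0//.
exact: leqW.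
Qed.

Lemma mxeval_drop F z i :
  mxeval (drop_poly i F) z = F`_i + mxeval (drop_poly i.+1 F) z * z%:M.
Proof.
rewrite -[z%:M]mxevalX -mxevalM -[F`_i](mxevalC _ z) -mxevalD.
congr (mxeval _ z); apply/polyP => -[|k].
  by rewrite coefD coef_drop_poly coefC coefMX !addr0.
rewrite coefD coefC coefMX !coef_drop_poly/= add0r.
by rewrite addnS addSn.
Qed.

Lemma divdiffP F z : divdiff F z * ('X - z%:M%:P) = F - (mxeval F z)%:P.
Proof.
apply/polyP => i; rewrite mulrBr !coefB coefMX coefMC !coef_divdiff coefC.
case: i => [|i] /=.
  by have := mxeval_drop F z 0; rewrite drop_poly0l => ->; rewrite opprD addrA subrr.
by rewrite (mxeval_drop F z i.+1) addrK subr0.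
Qed.

(** Leibniz rule for divided differences, obtained by cancelling the monic factor x - z. The divided
    difference of p has smaller degree than p, so orthogonality discards or simplifies the last
    term. *)
Lemma mul_divdiff p F z :
  p * divdiff F z = divdiff (p * F) z - divdiff p z * (mxeval F z)%:P.
Proof.
have mon : 'X - z%:M%:P \is @monic M by exact: monicXsubC.
apply: (monic_rreg mon); rewrite -mulrA divdiffP mulrBl divdiffP -mulrA.
have -> : (mxeval F z)%:P * ('X - (z%:M)%:P) = ('X - (z%:M)%:P) * (mxeval F z)%:P.
  by rewrite mulrBl mulrBr commr_polyX -!polyCM scalar_comm.
rewrite mulrA divdiffP mulrBr mulrBl mxevalM polyCM opprB addrA.
by rewrite subrK.
Qed.

End StarMatrix.

(** * Moment forms *)

Section MomentForm.
Context {R : realType} {N : nat}.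
Local Notation M := 'M[R[i]]_N.+1.
Implicit Types (A B : M) (p q G : {poly M}) (z : R[i]) (S : nat -> M).

(** The form \int p W q^* expressed through the moments [S k] = \int x^k W, so that the ladder
    theory becomes algebra on a moment sequence. *)
Definition mform S p q : M :=
  \sum_(i < size p) \sum_(j < size q) p`_i * S (i + j)%N * adj q`_j.

Lemma mformE S p q m n : (size p <= m)%N -> (size q <= n)%N ->
  mform S p q = \sum_(i < m) \sum_(j < n) p`_i * S (i + j)%N * adj q`_j.
Proof.
move=> hp hq; rewrite /mform (big_ord_widen _ (fun i =>
  \sum_(j < size q) p`_i * S (i + j)%N * adj q`_j) hp) big_mkcond /=.
apply: eq_bigr => i _; case: ltnP => hi; last first.
  by rewrite big1// => j _; rewrite nth_default// !mul0r.
rewrite (big_ord_widen _ (fun j => p`_i * S (i + j)%N * adj q`_j) hq).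
rewrite big_mkcond /=; apply: eq_bigr => j _; case: ltnP => hj //.
by rewrite [q`_j]nth_default// adj0 mulr0.
Qed.

Lemma mformDl S p1 p2 q : mform S (p1 + p2) q = mform S p1 q + mform S p2 q.
Proof.
have h1 : (size p1 <= maxn (size p1) (size p2))%N by rewrite leq_maxl.
have h2 : (size p2 <= maxn (size p1) (size p2))%N by rewrite leq_maxr.
rewrite (mformE S (size_polyD p1 p2) (leqnn _)) (mformE S h1 (leqnn _)).
rewrite (mformE S h2 (leqnn _)) -big_split; apply: eq_bigr => i _ /=.
by rewrite -big_split; apply: eq_bigr => j _; rewrite coefD !mulrDl.
Qed.

Lemma mformDr S p q1 q2 : mform S p (q1 + q2) = mform S p q1 + mform S p q2.
Proof.
have h1 : (size q1 <= maxn (size q1) (size q2))%N by rewrite leq_maxl.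
have h2 : (size q2 <= maxn (size q1) (size q2))%N by rewrite leq_maxr.
rewrite (mformE S (leqnn _) (size_polyD q1 q2)) (mformE S (leqnn _) h1).
rewrite (mformE S (leqnn _) h2) -big_split; apply: eq_bigr => i _ /=.
by rewrite -big_split; apply: eq_bigr => j _; rewrite coefD adjD mulrDr.
Qed.

Lemma mformCl S A p q : mform S (A%:P * p) q = A * mform S p q.
Proof.
rewrite (@mformE _ _ _ (size p) (size q))//; last first.
  by apply/leq_sizeP => j hj; rewrite coefCM nth_default// mulr0.
rewrite /mform mulr_sumr; apply: eq_bigr => i _; rewrite mulr_sumr.
by apply: eq_bigr => j _; rewrite coefCM !mulrA.
Qed.

Lemma mformCr S A p q : mform S p (A%:P * q) = mform S p q * adj A.
Proof.
rewrite (@mformE _ _ _ (size p) (size q))//; last first.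
  by apply/leq_sizeP => j hj; rewrite coefCM nth_default// mulr0.
rewrite /mform mulr_suml; apply: eq_bigr => i _; rewrite mulr_suml.
by apply: eq_bigr => j _; rewrite coefCM adjM !mulrA.
Qed.

Lemma mform0l S q : mform S 0 q = 0.
Proof. by rewrite /mform size_poly0 big_ord0. Qed.

Lemma mform0r S p : mform S p 0 = 0.
Proof. by rewrite /mform size_poly0 big1// => i _; rewrite big_ord0. Qed.

Lemma mformNl S p q : mform S (- p) q = - mform S p q.
Proof. by apply/eqP; rewrite -addr_eq0 -mformDl addNr mform0l. Qed.

Lemma mformNr S p q : mform S p (- q) = - mform S p q.
Proof. by apply/eqP; rewrite -addr_eq0 -mformDr addNr mform0r. Qed.

Lemma mform_suml S I (r : seq I) (Q : pred I) (F : I -> {poly M}) q :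
  mform S (\sum_(i <- r | Q i) F i) q = \sum_(i <- r | Q i) mform S (F i) q.
Proof.
apply: (big_morph (fun p => mform S p q)) => [p1 p2|]; first exact: mformDl.
exact: mform0l.
Qed.

Lemma mform_sumr S I (r : seq I) (Q : pred I) (F : I -> {poly M}) p :
  mform S p (\sum_(i <- r | Q i) F i) = \sum_(i <- r | Q i) mform S p (F i).
Proof.
apply: (big_morph (fun q => mform S p q)) => [q1 q2|]; first exact: mformDr.
exact: mform0r.
Qed.

Lemma mformXX S i j : mform S 'X^i 'X^j = S (i + j)%N.
Proof.
rewrite /mform !size_polyXn (bigD1 ord_max)//= [X in _ + X]big1 => [|k hk].
  rewrite (bigD1 ord_max)//= [X in _ + X + _]big1 => [|k hk].
    by rewrite !coefXn !eqxx adj1 mul1r mulr1 !addr0.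
  rewrite [in X in adj X]coefXn; case: eqP => [h|_]; last by rewrite adj0 mulr0.
  by case/eqP: hk; exact: val_inj.
apply: big1 => l _; rewrite coefXn; case: eqP => [h|_]; last by rewrite !mul0r.
by case/eqP: hk; exact: val_inj.
Qed.

Lemma mform_monomial S A B i j :
  mform S (A%:P * 'X^i) (B%:P * 'X^j) = A * S (i + j)%N * adj B.
Proof. by rewrite mformCl mformCr mformXX mulrA. Qed.

Lemma poly_coefC p : p = \sum_(i < size p) (p`_i)%:P * 'X^i.
Proof. by rewrite -[LHS]coefK poly_def; apply: eq_bigr => i _; rewrite mul_polyC. Qed.

Lemma biadditive_ext (f g : {poly M} -> {poly M} -> M) :
  (forall p1 p2 q, f (p1 + p2) q = f p1 q + f p2 q) ->
  (forall p q1 q2, f p (q1 + q2) = f p q1 + f p q2) ->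
  (forall p1 p2 q, g (p1 + p2) q = g p1 q + g p2 q) ->
  (forall p q1 q2, g p (q1 + q2) = g p q1 + g p q2) ->
  (forall A B i j, f (A%:P * 'X^i) (B%:P * 'X^j) = g (A%:P * 'X^i) (B%:P * 'X^j)) ->
  forall p q, f p q = g p q.
Proof.
have a0 (h : {poly M} -> M) : (forall p q, h (p + q) = h p + h q) -> h 0 = 0.
  by move=> hh; apply: (addrI (h 0)); rewrite -hh !addr0.
have asum (h : {poly M} -> M) : (forall p q, h (p + q) = h p + h q) ->
    forall n (F : 'I_n -> {poly M}), h (\sum_i F i) = \sum_i h (F i).
  by move=> hh n F; apply: (big_morph h) => //; exact: a0.
move=> fl fr gl gr hm p q; rewrite (poly_coefC p) (poly_coefC q).
rewrite (asum (f^~ _))// (asum (g^~ _))//; apply: eq_bigr => i _.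
by rewrite (asum (f _))// (asum (g _))//; apply: eq_bigr => j _.
Qed.

(** The variable is real, so it moves across the adjoint; on monomials this is the Hankel structure
    of the moments. *)
Lemma mformMX S p q : mform S (p * 'X) q = mform S p (q * 'X).
Proof.
move: p q; apply: biadditive_ext => [p1 p2 q|p q1 q2|p1 p2 q|p q1 q2|A B i j].
- by rewrite mulrDl mformDl.
- exact: mformDr.
- exact: mformDl.
- by rewrite mulrDl mformDr.
- by rewrite -!mulrA -!exprSr !mform_monomial addnS addSn.
Qed.

Lemma adj_mform S p q : (forall k, adj (S k) = S k) ->
  adj (mform S p q) = mform S q p.
Proof.
move=> hS; rewrite /mform adj_sum.
under eq_bigr do rewrite adj_sum; rewrite exchange_big /=.
apply: eq_bigr => j _; apply: eq_bigr => i _.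
by rewrite !adjM adjK hS mulrA addnC.
Qed.

(* The moment form of the relation [W' = G W + W G^*]. *)
Definition pearson S G : Prop := forall k,
  S k.-1 *+ k + \sum_(l < size G) (G`_l * S (k + l)%N + S (k + l)%N * adj G`_l) = 0.

(** Integration by parts: the four terms make up the derivative of p W q^* when W' = G W + W G^*. On
    monomials in x^i and x^j they reduce to [pearson] at i + j. *)
Lemma mform_parts S G p q : pearson S G ->
  mform S p^`() q + mform S (p * G) q + mform S p q^`() + mform S p (q * G) = 0.
Proof.
move=> hS; pose f p q := mform S p^`() q + mform S (p * G) q
  + mform S p q^`() + mform S p (q * G).
pose g (_ _ : {poly M}) : M := 0; change (f p q = g p q); move: p q.
apply: biadditive_ext => [p1 p2 q|p q1 q2|p1 p2 q|p q1 q2|A B i j];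
  rewrite /f /g ?addr0//.
- by rewrite derivD mulrDl !mformDl [LHS](AC (2*2*2*2) ((1*3*5*7)*(2*4*6*8))).
- by rewrite derivD mulrDl !mformDr [LHS](AC (2*2*2*2) ((1*3*5*7)*(2*4*6*8))).
have MG (C : M) k : C%:P * 'X^k * G = \sum_(l < size G) (C * G`_l)%:P * 'X^(k + l).
  rewrite {1}(poly_coefC G) mulr_sumr; apply: eq_bigr => l _.
  rewrite polyCM exprD -!mulrA; congr (_ * _).
  by rewrite [RHS]mulrA (commr_polyXn (G`_l)%:P k) -mulrA.
have dX (C : M) k : (C%:P * 'X^k)^`() = (C *+ k)%:P * 'X^(k.-1).
  by rewrite mul_polyC derivZ derivXn -mul_polyC polyCMn mulrnAl mulrnAr.
rewrite !MG !dX mform_suml mform_sumr !mform_monomial.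
under eq_bigr do rewrite mform_monomial.
under [X in _ + X]eq_bigr do rewrite mform_monomial adjM.
have adjMn (C : M) k : adj (C *+ k) = adj C *+ k.
  by elim: k => [|k IH]; rewrite ?mulr0n ?adj0// !mulrS adjD IH.
(* For i = 0 the truncated exponent [i.-1] is harmless, its coefficient being [A *+ 0]. *)
have -> : A *+ i * S (i.-1 + j)%N * adj B = A * (S (i + j).-1 *+ i) * adj B.
  case: i => [|i]; first by rewrite !mulr0n !mulr0 !mul0r.
  by rewrite addSn mulrnAl mulrnAr.
have -> : A * S (i + j.-1)%N * adj (B *+ j) = A * (S (i + j).-1 *+ j) * adj B.
  case: j => [|j]; first by rewrite !mulr0n adj0 !mulr0 !mul0r.
  by rewrite addnS adjMn mulrnAr mulrnAr mulrnAl.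
rewrite -addrA addrACA -mulrDl -mulrDr -mulrnDr.
have -> : \sum_(l < size G) A * G`_l * S (i + l + j)%N * adj B +
          \sum_(l < size G) A * S (i + (j + l))%N * (adj G`_l * adj B) =
   A * (\sum_(l < size G) (G`_l * S (i + j + l)%N + S (i + j + l)%N * adj G`_l)) * adj B.
  rewrite -big_split mulr_sumr mulr_suml; apply: eq_bigr => l _ /=.
  by rewrite addnAC addnA mulrDr mulrDl !mulrA.
by rewrite -mulrDl -mulrDr hS mulr0 mul0r.
Qed.

End MomentForm.

(** * Ladder relations *)

(* The operator [D p = p' + p G] is applied twice along the ladder
   [P_n -> P_{n-1} -> P_n]; [v = D p0 + B p0]. *)
Lemma ode_of_ladder (U : unitRingType)
    (p0 p1 p2 q0 q1 G G' A A' B B' E Am X be : U) :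
  A \is a GRing.unit ->
  p1 + p0 * G + B * p0 = A * be * q0 ->
  p2 + (p1 * G + p0 * G') + (B' * p0 + B * p1) = A' * be * q0 + A * be * q1 ->
  q1 + q0 * G = E * q0 - Am * p0 ->
  X * be = - (be * E) ->
  let Mn := - (A' * A^-1) + B + A * X * A^-1 in
  p2 + (p1 * G) *+ 2 + p0 * (G' + G * G) + Mn * p1
  + (Mn * B - B * B + B' + A * be * Am) * p0 + Mn * p0 * G = 0.
Proof.
move=> uA e1 e2 e3 e4 Mn; set v := A * be * q0 in e1.
have Mv : (Mn - B) * v = - (A' * be * q0) - A * be * E * q0.
  rewrite /Mn addrAC addrK /v mulrDl mulNr !mulrA divrK//; congr (_ + _).
  by rewrite divrK// -[_ * X * be]mulrA e4 mulrN !mulNr mulrA.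
have q1E : A * be * q1 = A * be * E * q0 - A * be * Am * p0 - v * G.
  by rewrite -[q1](addrK (q0 * G)) e3 !mulrBr !mulrA.
transitivity ((p2 + (p1 * G + p0 * G') + (B' * p0 + B * p1)) + v * G
              + (Mn - B) * v + A * be * Am * p0); last first.
  rewrite e2 Mv q1E.
  set a := A' * _ * _; set b := A * _ * _ * q0; set c := A * _ * _ * p0.
  set d := v * G; clearbody a b c d.
  rewrite [LHS](AC ((1*3)*1*2*1) ((1*6)*(2*7)*(3*8)*(4*5)))/=.
  by rewrite !subrr !addNr !addr0.
rewrite -e1 mulrBl; clearbody Mn; rewrite !mulrDr !mulrDl !mulNr mulr2n.
rewrite !mulrA !opprD [RHS](AC (1*2*2*3*(3*3)*1)
  (1*(2*6)*(3*7)*9*(11*14*4*15)*10*(5*12)*(8*13)))/=.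
by rewrite !subrr !addr0.
Qed.

(** * Orthogonal polynomials of a moment form: recurrence, lowering and compatibility relations *)

Section Ladder.
Context {R : realType} {N : nat}.
Local Notation M := 'M[R[i]]_N.+1.
Context (S : nat -> M) (G : {poly M}) (P : nat -> {poly M}).
Context (adjS : forall k, adj (S k) = S k) (pearsonS : pearson S G).
Context (monP : forall n, P n \is monic) (szP : forall n, size (P n) = n.+1).
Context (orthP : forall n (Q : {poly M}), (size Q <= n)%N -> mform S (P n) Q = 0).
Context (uP : forall n, mform S (P n) (P n) \is a GRing.unit).
Implicit Types (A B : M) (p q : {poly M}) (z : R[i]) (n k : nat).

Local Notation ip := (mform S).
Local Notation h n := (mform S (P n) (P n)).
Local Notation g n := (mform S (P n) (P n))^-1.

(** The conventions P_{-1} = 0 and gamma_{-1} = 0 let the relations below start at n = 0. *)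
Definition pred_poly n : {poly M} := if n is k.+1 then P k else 0.
Definition pred_gamma n : M := if n is k.+1 then g k else 0.
Local Notation Pm := pred_poly.
Local Notation gm := pred_gamma.

Lemma orthPl n q : (size q <= n)%N -> ip q (P n) = 0.
Proof. by move=> hq; rewrite -(adj_mform _ _ adjS) orthP// adj0. Qed.

Lemma orthP_lt n k : (k < n)%N -> ip (P n) (P k) = 0.
Proof. by move=> kn; rewrite orthP// szP. Qed.

Lemma orthP_gt n k : (k < n)%N -> ip (P k) (P n) = 0.
Proof. by move=> kn; rewrite orthPl// szP. Qed.

Lemma adj_h n : adj (h n) = h n.
Proof. exact: adj_mform. Qed.

Lemma adj_g n : adj (g n) = g n.
Proof. by rewrite adjV// adj_h. Qed.

Lemma leadP n : (P n)`_n = 1.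
Proof. by have /monicP := monP n; rewrite lead_coefE szP. Qed.

(** Induction on n: subtracting the top coefficient times the monic P_n lowers the size, and
    orthogonality identifies the coefficients. *)
Lemma orthogonal_expansion n q : (size q <= n)%N ->
  q = \sum_(k < n) (ip q (P k) * g k)%:P * P k.
Proof.
elim: n q => [|n IH] q hq.
  by rewrite big_ord0; apply/eqP; rewrite -size_poly_leq0.
set r := q - (q`_n)%:P * P n.
have sr : (size r <= n)%N.
  apply/leq_sizeP => j; rewrite leq_eqVlt => /predU1P[<-|hj].
    by rewrite coefB coefCM leadP mulr1 subrr.
  rewrite coefB coefCM (nth_default _ (leq_trans hq hj)).
  by rewrite [(P n)`_j]nth_default ?szP// mulr0 subrr.
have qE : q = r + (q`_n)%:P * P n by rewrite subrK.
rewrite {1}qE big_ord_recr /= {1}(IH r sr); congr (_ + _).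
  apply: eq_bigr => k _; rewrite [in RHS]qE mformDl mformCl.
  by rewrite (orthP_lt (ltn_ord k)) mulr0 addr0.
have -> : ip q (P n) = q`_n * h n by rewrite {1}qE mformDl mformCl orthPl// add0r.
by rewrite mulrK.
Qed.

(* [locked] keeps unification from looking for sums inside the coefficients. *)
Definition rec_alpha n : M :=
  locked ((P n)`_n.-1 *+ (0 < n)%N - (P n.+1)`_n).
Definition rec_beta n : M := locked (h n * gm n).
Local Notation al := rec_alpha.
Local Notation be := rec_beta.

(** The remainder x P_n - P_{n+1} - alpha_n P_n has degree below n; multiplication by x being
    symmetric for the form, only P_{n-1} occurs in its expansion. *)
Lemma recurrence n : P n * 'X = P n.+1 + (al n)%:P * P n + (be n)%:P * Pm n.
Proof.
set r := P n * 'X - P n.+1 - (al n)%:P * P n.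
have sr : (size r <= n)%N.
  apply/leq_sizeP => j; rewrite !coefB coefMX coefCM.
  rewrite leq_eqVlt => /predU1P[<-|].
    (* The choice of [rec_alpha] cancels the coefficient of x^n; that of x^{n+1} cancels because
       both polynomials are monic. *)
    rewrite leadP mulr1 /rec_alpha -lock; case: n @r => [|m] _ /=.
      by rewrite mulr0n !sub0r subrr.
    by rewrite mulr1n subrr.
  rewrite leq_eqVlt => /predU1P[<-|hj].
    by rewrite /= !leadP [X in _ * X]nth_default ?szP// mulr0 subr0 subrr.
  case: j hj => // j hj; rewrite /=.
  by rewrite !nth_default ?szP ?mulr0 ?subrr// (ltnW hj).
suff -> : (be n)%:P * Pm n = r
  by rewrite /r [RHS](AC (2*3) (3*(1*4)*(2*5)))/= !subrr !addr0.
have rP k : (k < n)%N -> ip r (P k) = ip (P n) (P k * 'X).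
  move=> kn; rewrite !mformDl !mformNl mformCl !orthP_lt ?(ltnW kn)//; last exact: leqW.
  by rewrite mulr0 oppr0 !addr0 mformMX.
rewrite (orthogonal_expansion sr); case: n @r sr rP => [|n] r sr rP.
  by rewrite big_ord0 mulr0.
rewrite big_ord_recr /= big1 ?add0r => [|k _]; last first.
  have kn : (k < n)%N := ltn_ord k.
  rewrite (rP _ (leqW kn)) orthP ?mul0r ?polyC0 ?mul0r//.
  by rewrite size_mulX ?szP// monic_neq0.
congr (_%:P * _); rewrite rP// /rec_beta -lock; congr (_ * _).
(* x P_n is P_{n+1} plus a polynomial of degree at most n, which P_{n+1} annihilates. *)
have -> : P n * 'X = P n.+1 + (P n * 'X - P n.+1) by rewrite addrC subrK.
rewrite mformDr [X in _ + X]orthP ?addr0//; apply/leq_sizeP => j.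
rewrite coefB coefMX leq_eqVlt => /predU1P[<-|]; first by rewrite /= !leadP subrr.
case: j => // j hj; rewrite /= !nth_default ?szP ?subrr//.
Qed.

(** [al n * h n] is the form at (x P_n, P_n), which is Hermitian because multiplication by x is
    symmetric. *)
Lemma adj_alpha n : adj (al n) * g n = g n * al n.
Proof.
have e : ip (P n * 'X) (P n) = al n * h n.
  rewrite recurrence !mformDl !mformCl (orthP_lt (ltnSn n)) add0r.
  by case: n => [|n] /=; rewrite ?mform0l ?(orthP_gt (ltnSn n)) mulr0 addr0.
have : adj (al n * h n) = al n * h n by rewrite -e adj_mform// mformMX.
rewrite adjM adj_h => e'; apply: (mulrI (uP n)); rewrite !mulrA e'.
by rewrite mulrK// divrr// mul1r.
Qed.

Lemma adj_beta n : adj (be n) * g n = gm n.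
Proof.
rewrite /rec_beta -lock adjM adj_h; case: n => [|n] /=; first by rewrite adj0 !mul0r.
by rewrite adj_g mulrK.
Qed.

Lemma gamma_beta n : g n * be n = gm n.
Proof. by rewrite /rec_beta -lock mulKr. Qed.

(* The functional [ell] stands for [q |-> \int F W q^*], and the left-hand side
   for its value on [(x - z) K_n(x, z)], [K_n] being the reproducing kernel. *)
Lemma christoffel_darboux (ell : {poly M} -> M) z n :
  (forall p q, ell (p + q) = ell p + ell q) ->
  (forall A q, ell (A%:P * q) = ell q * adj A) ->
  \sum_(k < n) (ell (P k * 'X) - ell (P k) * z%:M) * g k * mxeval (P k) z
  = ell (P n) * gm n * mxeval (Pm n) z - ell (Pm n) * gm n * mxeval (P n) z.
Proof.
move=> ellD ellC; have ell0 : ell 0 = 0.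
  by apply: (addrI (ell 0)); rewrite -ellD !addr0.
elim: n => [|n IH]; first by rewrite big_ord0 /= ell0 mulr0 !mul0r subrr.
rewrite big_ord_recr /= IH recurrence !ellD !ellC.
have /(congr1 (fun p => mxeval p z)) := recurrence n.
rewrite !mxevalD !mxevalM !mxevalC mxevalX -scalar_comm => rz.
set a := ell (P n) * gm n * _; set b := ell (Pm n) * gm n * _.
set c := ell (P n.+1) * g n * _; set e := ell (P n) * g n * _.
have -> : (ell (P n.+1) + ell (P n) * adj (al n) + ell (Pm n) * adj (be n)
           - ell (P n) * z%:M) * g n * mxeval (P n) z = c - e - a + b.
  rewrite !mulrDl !mulNr -[_ * adj (al n) * _]mulrA adj_alpha.
  rewrite -[_ * adj (be n) * _]mulrA adj_beta -/b -/c.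
  have -> : ell (P n) * z%:M * g n * mxeval (P n) z =
      e + ell (P n) * (g n * al n) * mxeval (P n) z + a.
    rewrite -[_ * z%:M * _]mulrA scalar_comm !mulrA -[_ * z%:M * _]mulrA rz.
    by rewrite 2!mulrDr /e /a -(gamma_beta n) !mulrA.
  by rewrite !opprD [LHS](AC (3*3) (1*4*6*3*(2*5)))/= subrr addr0.
clearbody a b c e.
by rewrite [LHS](AC (2*4) (3*4*(1*5)*(2*6)))/= subrr addNr !addr0.
Qed.

(** The form Phi_z(p, q). The second slot enters through its adjoint, hence the conjugate point
    there. *)
Definition ladder_form z p q : M :=
  locked (ip (p * divdiff G z) q + ip p (q * divdiff G (Num.conj z))).
Local Notation Phi := ladder_form.

Lemma ladder_formE z p q : Phi z p q =
  ip (p * divdiff G z) q + ip p (q * divdiff G (Num.conj z)).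
Proof. by rewrite /ladder_form -lock. Qed.

Lemma PhiDl z p1 p2 q : Phi z (p1 + p2) q = Phi z p1 q + Phi z p2 q.
Proof. by rewrite !ladder_formE mulrDl !mformDl addrACA. Qed.

Lemma PhiDr z p q1 q2 : Phi z p (q1 + q2) = Phi z p q1 + Phi z p q2.
Proof. by rewrite !ladder_formE mulrDl !mformDr addrACA. Qed.

Lemma PhiCl z A p q : Phi z (A%:P * p) q = A * Phi z p q.
Proof. by rewrite !ladder_formE -mulrA !mformCl mulrDr. Qed.

Lemma PhiCr z A p q : Phi z p (A%:P * q) = Phi z p q * adj A.
Proof. by rewrite !ladder_formE -mulrA !mformCr mulrDl. Qed.

Lemma Phi0r z p : Phi z p 0 = 0.
Proof. by rewrite !ladder_formE mul0r !mform0r addr0. Qed.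

Lemma PhiMX z p q : Phi z (p * 'X) q = Phi z p (q * 'X).
Proof.
by rewrite !ladder_formE -!mulrA -!commr_polyX !mulrA !mformMX.
Qed.

Lemma adj_Phi z p q : adj (Phi (Num.conj z) p q) = Phi z q p.
Proof. by rewrite !ladder_formE adjD !adj_mform// conjCK addrC. Qed.

(** Multiplying by x - z cancels the denominators of both divided differences. *)
Lemma Phi_shift z p q : Phi z p (q * 'X) - Phi z p q * z%:M =
  ip (p * G) q + ip p (q * G)
  - ip (p * (mxeval G z)%:P) q - ip p (q * (mxeval G (Num.conj z))%:P).
Proof.
have XP x (r : {poly M}) : r * 'X - x%:M%:P * r = r * ('X - x%:M%:P).
  rewrite mulrBr; congr (_ - _).
  by apply/polyP => i; rewrite coefMC coefCM scalar_comm.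
rewrite !ladder_formE mulrDl opprD addrACA -[RHS]addrA [RHS]addrACA.
congr (_ + _).
  rewrite -scalar_comm -mformCl -mformMX -!mformNl -!mformDl.
  by rewrite XP -mulrA divdiffP mulrBr.
rewrite -[z in _ * z%:M]conjCK -adj_scalar -mformCr -!mformNr -!mformDr.
rewrite -[q * 'X * _]mulrA -commr_polyX mulrA XP -mulrA divdiffP.
by rewrite mulrBr.
Qed.

Lemma size_deriv_P n : (size (P n)^`() <= n)%N.
Proof.
have := lt_size_deriv (monic_neq0 (monP n)).
by rewrite szP ltnS.
Qed.

Lemma size_mulC p A : (size (p * A%:P)%R <= size p)%N.
Proof. by apply/leq_sizeP => j hj; rewrite coefMC nth_default// mul0r. Qed.

(** P_n' is expanded along P_0, ..., P_{n-1}; integration by parts and [Phi_shift] give the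
    coefficients, and [christoffel_darboux] for q |-> Phi_z(P_n, q) sums the expansion in closed
    form. *)
Lemma ladder z n :
  mxeval (P n)^`() z + mxeval (P n) z * mxeval G z
  = - (Phi z (P n) (P n) * gm n) * mxeval (Pm n) z
    + (Phi z (P n) (Pm n) * gm n + mxeval G z) * mxeval (P n) z.
Proof.
set C := mxeval G z.
have expand q : (size q <= n)%N ->
    mxeval q z = \sum_(k < n) ip q (P k) * g k * mxeval (P k) z.
  move=> hq; rewrite {1}(orthogonal_expansion hq) mxeval_sum.
  by apply: eq_bigr => k _; rewrite mxevalM mxevalC.
(* P_n being monic, the leading terms of P_n C and C P_n agree, so the commutator admits the same
   expansion. *)
have sr : (size (P n * C%:P - C%:P * P n)%R <= n)%N.
  apply/leq_sizeP => j; rewrite coefB coefMC coefCM.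
  rewrite leq_eqVlt => /predU1P[<-|hj]; first by rewrite leadP mul1r mulr1 subrr.
  by rewrite nth_default ?szP// mul0r mulr0 subrr.
have commE : mxeval (P n) z * C - C * mxeval (P n) z =
    \sum_(k < n) ip (P n * C%:P) (P k) * g k * mxeval (P k) z.
  have := expand _ sr; rewrite mxevalD mxevalN !mxevalM mxevalC => ->.
  apply: eq_bigr => k _; rewrite mformDl mformNl mformCl.
  by rewrite (orthP_lt (ltn_ord k)) mulr0 subr0.
have derE : mxeval (P n)^`() z = - (\sum_(k < n)
    (Phi z (P n) (P k * 'X) - Phi z (P n) (P k) * z%:M) * g k * mxeval (P k) z)
    - (mxeval (P n) z * C - C * mxeval (P n) z).
  rewrite commE -sumrN -sumrB (expand _ (size_deriv_P n)).
  apply: eq_bigr => k _; rewrite -mulNr -mulrBl -mulNr -mulrBl.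
  congr (_ * _ * _); rewrite Phi_shift.
  (* For k < n, both P_k' and P_k times a constant have degree below n, so P_n annihilates them. *)
  have h1 : ip (P n) (P k)^`() = 0.
    by apply/orthP/(leq_trans (size_deriv_P k))/ltnW.
  have h2 : ip (P n) (P k * (mxeval G (Num.conj z))%:P) = 0.
    by apply/orthP/(leq_trans (size_mulC _ _)); rewrite szP.
  have := mform_parts (P n) (P k) pearsonS; rewrite h1 h2 subr0 addr0 -addrA.
  by move=> /eqP; rewrite addr_eq0 => /eqP ->; rewrite -/C opprB addrAC subrr sub0r.
rewrite derE (christoffel_darboux _ _ (@PhiDr z (P n))); last first.
  by move=> A q; exact: PhiCr.
rewrite opprB [- (_ - C * _)]opprB mulrDl mulNr.
set a := _ * mxeval (Pm n) z; set b := _ * mxeval (P n) z.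
set c := C * _; set d := _ * C.
by rewrite [LHS](AC (2*2*1) (2*(1*3)*(4*5)))/= addNr addr0.
Qed.

(** On the diagonal both derivative terms vanish by degree, and P_n C may be replaced by C P_n,
    their difference having degree below n. *)
Lemma Phi_shift_diag z n :
  Phi z (P n) (P n * 'X) - Phi z (P n) (P n) * z%:M =
  - (mxeval G z * h n + h n * adj (mxeval G (Num.conj z))).
Proof.
have CP C : P n * C%:P = C%:P * P n + (P n * C%:P - C%:P * P n).
  by rewrite addrC subrK.
have sr C : (size (P n * C%:P - C%:P * P n)%R <= n)%N.
  apply/leq_sizeP => j; rewrite coefB coefMC coefCM.
  rewrite leq_eqVlt => /predU1P[<-|hj]; first by rewrite leadP mul1r mulr1 subrr.
  by rewrite nth_default ?szP// mul0r mulr0 subrr.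
rewrite Phi_shift (CP (mxeval G z)) (CP (mxeval G (Num.conj z))) mformDl mformDr.
rewrite mformCl mformCr (orthP (sr _)) (orthPl (sr _)) !addr0.
have := mform_parts (P n) (P n) pearsonS.
rewrite (orthP (size_deriv_P n)) (orthPl (size_deriv_P n)) add0r addr0 => ->.
by rewrite sub0r opprD.
Qed.

(** [Phi_shift_diag] with x moved to the left slot and expanded there by the recurrence. In the
    notation of [compat], the left side is b_{n+1} - (z - alpha_n) a_n. *)
Lemma compat_up z n :
  (z%:M - al n) * (Phi z (P n) (P n) * g n)
  - (Phi z (P n.+1) (P n) * g n + mxeval G z)
  = be n * Phi z (Pm n) (P n) * g n
    + h n * adj (mxeval G (Num.conj z)) * g n.
Proof.
have := Phi_shift_diag z n; rewrite -PhiMX recurrence !PhiDl !PhiCl -scalar_comm.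
move=> /(congr1 (fun A => A * g n)); rewrite !mulNr !mulrDl !mulNr mulrK// !mulrA.
set f := _ / h n; set a := al n * _ / _; set b := be n * _ / _.
set c := mxeval G z; set e := z%:M * _ * _; set d := h n * _ / h n.
move=> E; have -> : d = - (f + a + b - e) - c by rewrite E opprK addrC addKr.
clearbody a b c d e f; rewrite !opprD opprK.
by rewrite [RHS](AC (1*(4*1)) (5*3*(2*6)*(1*4)))/= subrr addr0.
Qed.

(** [Phi_shift_diag] with x P_n expanded in the right slot. The left side is b_n - a_n (z -
    alpha_n). *)
Lemma compat_down z n :
  Phi z (P n) (P n) * g n * (z%:M - al n)
  - (Phi z (P n) (Pm n) * gm n + mxeval G z)
  = Phi z (P n) (P n.+1) * g n + h n * adj (mxeval G (Num.conj z)) * g n.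
Proof.
have := Phi_shift_diag z n; rewrite recurrence !PhiDr !PhiCr.
move=> /(congr1 (fun A => A * g n)); rewrite !mulNr !mulrDl !mulNr mulrK//.
rewrite -[_ * adj (al n) * _]mulrA adj_alpha -[_ * adj (be n) * _]mulrA adj_beta.
rewrite -[_ * z%:M * _]mulrA scalar_comm !mulrA mulrDr mulrN.
set f := Phi _ _ (P n.+1) * _; set a := _ * al n; set b := _ * gm n.
set c := mxeval G z; set e := _ * z%:M; set d := h n * _ / h n.
move=> E; have -> : d = - (f + a + b - e) - c by rewrite E opprK addrC addKr.
clearbody a b c d e f; rewrite !opprD opprK.
by rewrite [RHS](AC (1*(4*1)) (5*3*(4*6)*(1*2)))/= subrr addr0.
Qed.

(* This cannot be read off from the two ladder relations by comparing
   coefficients, [P n] and [P n.+1] not being independent over the matrix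
   polynomials: both sides are computed through [Phi z (P n) (P n.+1)]. *)
Lemma compat z n (a := fun k => - (Phi z (P k) (P k) * g k))
    (b := fun k => - (Phi z (P k) (Pm k) * gm k + mxeval G z)) :
  (b n.+2 - (z%:M - al n.+1) * a n.+1) * be n.+1
  = - (be n.+1 * (a n * (z%:M - al n) - b n)).
Proof.
have := compat_up z n.+1; have := compat_down z n => /= dn up.
rewrite /a /b /= mulrN opprK addrC up [in RHS]mulNr -opprD [in RHS]mulrN opprK dn.
rewrite mulrDl mulrDr -[_ * g n.+1 * _]mulrA gamma_beta -mulrA; congr (_ + _).
  by rewrite mulrA.
rewrite !mulrA -[_ * be n.+1]mulrA gamma_beta /rec_beta -lock /=.
by rewrite divrK.
Qed.

(** Here [A k] stands for A_k^* and [B k] for B_k; they are polynomials so that the lowering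
    relation can be differentiated. *)
Lemma ladder_ode (A B : nat -> {poly M}) n z :
  (forall k x, mxeval (A k) x = - (Phi x (P k) (P k) * g k)) ->
  (forall k x, mxeval (B k) x = - (Phi x (P k) (Pm k) * gm k + mxeval G x)) ->
  mxeval (A n.+1) z \is a GRing.unit ->
  let p := P n.+1 in
  let Mn := - (mxeval (A n.+1)^`() z * (mxeval (A n.+1) z)^-1)
    + mxeval (B n.+1) z + mxeval (A n.+1) z
      * (mxeval (B n.+2) z - (z%:M - al n.+1) * mxeval (A n.+1) z)
      * (mxeval (A n.+1) z)^-1 in
  mxeval p^`()^`() z + (mxeval p^`() z * mxeval G z) *+ 2
  + mxeval p z * (mxeval G^`() z + mxeval G z * mxeval G z)
  + Mn * mxeval p^`() z
  + (Mn * mxeval (B n.+1) z - mxeval (B n.+1) z * mxeval (B n.+1) z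
     + mxeval (B n.+1)^`() z + mxeval (A n.+1) z * be n.+1 * mxeval (A n) z)
    * mxeval p z
  + Mn * mxeval p z * mxeval G z = 0.
Proof.
move=> evA evB uA.
have lad k x : mxeval (P k)^`() x + mxeval (P k) x * mxeval G x
    + mxeval (B k) x * mxeval (P k) x = mxeval (A k) x * be k * mxeval (Pm k) x.
  rewrite ladder evA evB -[_ + _ + _ * _]addrA -mulrDl subrr mul0r addr0.
  by rewrite -!mulNr -[_ * g k * be k]mulrA gamma_beta.
(* Valid at every point, the lowering relation is a polynomial identity; its derivative is the
   second relation fed to [ode_of_ladder]. *)
have ladp k : (P k)^`() + P k * G + B k * P k = A k * (be k)%:P * Pm k.
  by apply: mxeval_inj => x; rewrite !mxevalD !mxevalM mxevalC lad.
apply: (ode_of_ladder (q0 := mxeval (P n) z) (q1 := mxeval (P n)^`() z)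
  (E := mxeval (A n) z * (z%:M - al n) - mxeval (B n) z)) => //.
- have /(congr1 (fun p : {poly M} => mxeval p^`() z)) := ladp n.+1.
  rewrite !derivD !derivM derivC mulr0 addr0.
  by rewrite !(mxevalD, mxevalM, mxevalC).
(* The recurrence replaces beta_n P_{n-1} in the relation for P_n by (z - alpha_n) P_n - P_{n+1},
   whence the choice of [E]. *)
- have rz := congr1 (fun p : {poly M} => mxeval p z) (recurrence n).
  rewrite !mxevalD !mxevalM !mxevalC mxevalX -scalar_comm in rz.
  have bpm : be n * mxeval (Pm n) z
      = (z%:M - al n) * mxeval (P n) z - mxeval (P n.+1) z.
    by rewrite mulrBl rz [RHS](AC (3*1*1) (3*(2*4)*(1*5)))/= !subrr !addr0.
  apply: (addIr (mxeval (B n) z * mxeval (P n) z)).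
  by rewrite lad -mulrA bpm [in LHS]mulrBr [in RHS]mulrBl mulrA [RHS]addrAC subrK.
- by rewrite !evA !evB; exact: compat.
Qed.

End Ladder.

(** * The coefficients A_n and B_n *)

Section PolynomialPart.
Context {R : realType} {N : nat}.
Local Notation M := 'M[R[i]]_N.+1.
Implicit Types (P : nat -> {poly M}) (K p q F : {poly M}) (A : M) (z : R[i]).

Lemma acoef_sub P n s :
  acoef P n (n%:Z - s%:Z) = if (s <= n)%N then (P n)`_(n - s) else 0.
Proof.
case: leqP => h; first by rewrite subzn.
suff -> : (n%:Z - s%:Z = Negz (s - n).-1)%R by [].
by rewrite NegzE prednK ?subn_gt0// -subzn ?opprB// ltnW.
Qed.

(** P_{n,k} is the polynomial part of z^{k-n} P_n, for k <= n and k > n alike. *)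
Lemma Ptrunc_drop P n k : size (P n) = n.+1 ->
  Ptrunc P n k = drop_poly n (P n * 'X^k).
Proof.
move=> szP; have -> : Ptrunc P n k = \poly_(i < k.+1) acoef P n (n%:Z - (k - i)%N%:Z).
  rewrite /Ptrunc (reindex_inj rev_ord_inj) poly_def; apply: eq_bigr => i _ /=.
  by rewrite mul_polyC subSS subKn// -ltnS.
apply/polyP => t; rewrite coef_poly coef_drop_poly coefMXn acoef_sub ltnS.
case: (leqP t k) => tk; last first.
  by case: ltnP => // h; rewrite nth_default// szP; lia.
case: (leqP (k - t) n) => h1; case: ltnP => h2 //; [lia|congr (_`__); lia|lia].
Qed.

Lemma drop_polyMC n p A : drop_poly n (p * A%:P) = drop_poly n p * A%:P.
Proof. by apply/polyP => i; rewrite coefMC !coef_drop_poly coefMC. Qed.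

Lemma drop_polyMXn_add n s p : drop_poly (n + s) (p * 'X^s) = drop_poly n p.
Proof.
apply/polyP => i; rewrite !coef_drop_poly coefMXn addnA ltnNge leq_addl /=.
by rewrite addnK.
Qed.

(** Delta_{j,n} is the polynomial part of P_n K divided by z^{n+m-j}: the coefficients of K below m
    - j only reach lower degrees. *)
Lemma Delta_drop P K n j : size (P n) = n.+1 -> (j <= deg_mx K)%N ->
  Delta P K j n = drop_poly (n + deg_mx K - j) (P n * K).
Proof.
set m := deg_mx K => szP jm.
have szK : (size K <= m.+1)%N by rewrite /m /deg_mx leqSpred.
rewrite -{2}(poly_take_drop (m - j) K) mulrDr drop_polyD.
rewrite [X in X + _]drop_poly_eq0 ?add0r; last first.
  apply: leq_trans (size_polyMleq _ _) _; rewrite szP /=.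
  by rewrite -addnBA// leq_add2l size_take_poly.
rewrite mulrA -addnBA// drop_polyMXn_add.
have -> : drop_poly (m - j) K = \sum_(k < j.+1) (K`_(m - j + k))%:P * 'X^k.
  transitivity (\poly_(k < j.+1) K`_(m - j + k)); last first.
    by rewrite poly_def; apply: eq_bigr => k _; rewrite mul_polyC.
  apply/polyP => k; rewrite coef_poly coef_drop_poly addnC.
  case: ltnP => // h; rewrite nth_default// (leq_trans szK)//.
  by clearbody m; lia.
rewrite mulr_sumr drop_poly_sum; apply: eq_bigr => k _.
rewrite (commr_polyXn (K`_(m - j + k))%:P k) mulrA drop_polyMC.
by rewrite Ptrunc_drop.
Qed.

(** The hypothesis on q removes the exponents below k; reversing the order of the other m gives the
    sum over j of the explicit formulas. *)
Lemma mform_divdiff (S : nat -> M) F q z k m :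
  (forall r : {poly M}, (size r <= k)%N -> mform S r q = 0) -> (size F <= k + m.+1)%N ->
  mform S (divdiff F z) q = \sum_(j < m)
     mxeval (drop_poly (k + m - j) F) z * mform S 'X^(k + m - j - 1) q.
Proof.
move=> hq hF.
have -> : divdiff F z = \sum_(i < k + m) (mxeval (drop_poly i.+1 F) z)%:P * 'X^i.
  transitivity (\poly_(i < k + m) mxeval (drop_poly i.+1 F) z); last first.
    by rewrite poly_def; apply: eq_bigr => i _; rewrite mul_polyC.
  apply/polyP => i; rewrite coef_divdiff coef_poly; case: ltnP => // h.
  by rewrite drop_poly_eq0 ?mxeval0//; lia.
rewrite mform_suml big_split_ord /= big1 ?add0r => [|i _]; last first.
  by rewrite mformCl hq ?mulr0// size_polyXn.
rewrite (reindex_inj rev_ord_inj); apply: eq_bigr => j _ /=.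
rewrite mformCl; congr (mxeval (drop_poly _ F) z * mform S 'X^_ q).
  by have := ltn_ord j; lia.
by have := ltn_ord j; lia.
Qed.

End PolynomialPart.

(** * Identification of the explicit sums with the form Phi *)

Section Linking.
Context {R : realType} {N : nat}.
Local Notation M := 'M[R[i]]_N.+1.
Context (W : R -> 'M[R]_N.+1) (S : nat -> M) (G : {poly M}) (P : nat -> {poly M}).
Context (adjS : forall k, adj (S k) = S k).
Context (innerE : forall p q, mxinner W p q = mform S p q).
Context (momentE : forall p k,
  mxintegral (fun x => (x ^+ k)%:C *: (real_mxeval p x *m cweight W x))
  = mform S p 'X^k).
Context (hP : monic_orthogonal W P).
Context (uP : forall n, mform S (P n) (P n) \is a GRing.unit).
Local Notation ip := (mform S).
Local Notation h n := (mform S (P n) (P n)).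
Local Notation g n := (mform S (P n) (P n))^-1.
Local Notation m := (deg_mx G).
Local Notation Phi := (ladder_form S G).

Lemma size_monic_orthogonal n : size (P n) = n.+1.
Proof. by have [] := hP n. Qed.

Lemma mform_orth n (Q : {poly M}) : (size Q <= n)%N -> ip (P n) Q = 0.
Proof. by move=> hQ; have [_ _ o] := hP n; rewrite -innerE o. Qed.

Lemma mform_orthl n (Q : {poly M}) : (size Q <= n)%N -> ip Q (P n) = 0.
Proof. by move=> hQ; rewrite -(adj_mform _ _ adjS) mform_orth// adj0. Qed.

(** The cutoff in [bcoef] agrees with orthogonality: the integral itself vanishes for k < n. *)
Lemma bcoefE n k : bcoef W P n k = ip (P n) 'X^k.
Proof.
rewrite /bcoef; case: leqP => // h; rewrite mform_orth// size_polyXn//.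
Qed.

Lemma adj_bcoef n k : (bcoef W P n k) ^t* = ip 'X^k (P n).
Proof. by rewrite bcoefE -/(adj _) adj_mform. Qed.

Lemma gammaE n : gamma_mx W P n = g n.
Proof. by rewrite /gamma_mx innerE. Qed.

Lemma betaE n : beta_mx W P n = rec_beta S P n.
Proof.
case: n => [|n]; rewrite /beta_mx /rec_beta -lock /=; first by rewrite mulr0.
by rewrite !gammaE -[invmx _]/(_^-1) invrK.
Qed.

Lemma alphaE n : alpha_mx P n = rec_alpha P n.
Proof.
rewrite /alpha_mx /rec_alpha -lock (acoef_sub P n 1).
case: n => [|n] /=; first by rewrite mulr0n.
by rewrite subn1 mulr1n.
Qed.

Lemma size_mulPG k : (size (P k * G)%R <= k + m.+1)%N.
Proof.
apply: leq_trans (size_polyMleq _ _) _; rewrite size_monic_orthogonal addSn /=.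
by rewrite leq_add2l /deg_mx leqSpred.
Qed.

Lemma mxeval_Delta k j z : (j <= m)%N ->
  mxeval (Delta P G j k) z = mxeval (drop_poly (k + m - j) (P k * G)) z.
Proof. by move=> jm; rewrite Delta_drop// size_monic_orthogonal. Qed.

Lemma size_divdiffP k z A : (size (divdiff (P k) z * A%:P)%R <= k)%N.
Proof.
apply/leq_sizeP => i hi; rewrite coefMC coef_divdiff drop_poly_eq0 ?mxeval0 ?mul0r//.
by rewrite size_monic_orthogonal.
Qed.

(** By [mul_divdiff], P_k times the divided difference of G becomes that of P_k G, up to a
    correction of size at most k, which pairs to zero with q. *)
Lemma mform_Delta k q z : (forall r : {poly M}, (size r <= k)%N -> ip r q = 0) ->
  ip (P k * divdiff G z) q
  = \sum_(j < m) mxeval (Delta P G j k) z * ip 'X^(k + m - j - 1) q.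
Proof.
move=> hq; rewrite mul_divdiff mformDl mformNl (hq _ (size_divdiffP _ _ _)) subr0.
rewrite (mform_divdiff z hq (size_mulPG k)); apply: eq_bigr => j _.
by rewrite mxeval_Delta// ltnW.
Qed.

(** The second argument is one degree lower, so a term j = m appears; moreover the divided
    difference of P_{k+1} is monic of degree k and contributes G(z) h_k, which cancels the summand
    G(z) in [mxeval_calB]. *)
Lemma mform_Delta_pred k z :
  ip (P k.+1 * divdiff G z) (P k)
  = \sum_(j < m.+1) mxeval (Delta P G j k.+1) z * ip 'X^(k.+1 + m - j - 1) (P k)
    - mxeval G z * h k.
Proof.
rewrite mul_divdiff mformDl mformNl; congr (_ - _).
  have sF : (size (P k.+1 * G)%R <= k + m.+2)%N by rewrite -addSnnS size_mulPG.
  rewrite (mform_divdiff z (@mform_orthl k) sF); apply: eq_bigr => j _.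
  by rewrite (mxeval_Delta _ _ (ltn_ord j)) -addSnnS.
set C := mxeval G z; apply/eqP; rewrite -subr_eq0 -mformCl -mformNl -mformDl.
rewrite mform_orthl//; apply/leq_sizeP => i.
rewrite leq_eqVlt => /predU1P[<-|hi]; rewrite coefB coefMC coefCM coef_divdiff.
  have -> : drop_poly k.+1 (P k.+1) = 1.
    have [mon sz _] := hP k.+1; have := monicP mon; rewrite lead_coefE sz => l1.
    apply/polyP => -[|l]; rewrite coef_drop_poly coef1//=.
    by rewrite nth_default// sz; lia.
  rewrite -polyC1 mxevalC mul1r; have [mon sz _] := hP k.
  by have := monicP mon; rewrite lead_coefE sz => ->; rewrite mulr1 subrr.
rewrite drop_poly_eq0 ?size_monic_orthogonal// mxeval0 mul0r.
by rewrite nth_default ?size_monic_orthogonal// mulr0 subrr.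
Qed.

Lemma adj_mxeval_star K z : mxeval (mxpoly_star K) z = adj (mxeval K (Num.conj z) : M).
Proof. exact: mxeval_star. Qed.

(** The two halves of the sum are the two terms of Phi, each the adjoint of the other at the
    conjugate point. *)
Lemma mxeval_calA n z : mxeval (calA W P G n) z = - (g n * Phi z (P n) (P n)).
Proof.
rewrite /calA mxevalN mxevalM mxevalC gammaE mxeval_sum; congr (- (_ * _)).
rewrite ladder_formE (mform_Delta _ (@mform_orthl n)).
rewrite -(adj_mform _ _ adjS) (mform_Delta _ (@mform_orthl n)) adj_sum -big_split.
apply: eq_bigr => j _ /=; rewrite mxevalD !mxevalM !mxevalC adj_bcoef.
by rewrite adj_mxeval_star bcoefE adjM adj_mform// addrC.
Qed.

Lemma mxeval_calA_star n z :
  mxeval (mxpoly_star (calA W P G n)) z = - (Phi z (P n) (P n) * g n).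
Proof.
rewrite adj_mxeval_star mxeval_calA adjN adjM adj_Phi//.
by rewrite adjV// adj_mform.
Qed.

Lemma mxeval_calB n z : mxeval (calB W P G n) z =
  - (Phi z (P n) (pred_poly P n) * pred_gamma S P n + mxeval G z).
Proof.
case: n => [|n]; first by rewrite /= Phi0r mul0r add0r mxevalN.
rewrite /calB mxevalN mxevalM mxevalC mxeval_sum gammaE; congr (- _) => /=.
rewrite ladder_formE mform_Delta_pred.
have orth1 (r : {poly M}) : (size r <= n)%N -> ip r (P n.+1) = 0.
  by move=> hr; rewrite mform_orthl// ltnW.
rewrite -[ip (P n.+1) _](adj_mform _ _ adjS) (mform_Delta _ orth1) adj_sum.
rewrite addrAC mulrBl mulrK// subrK; congr (_ * _).
under eq_bigr do rewrite mxevalD !mxevalM !mxevalC adj_bcoef.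
rewrite big_split /=; congr (_ + _).
(* The term j = m has exponent n - 1, or 0 for n = 0 by truncated subtraction; P_{n+1} annihilates
   that power in both cases. *)
rewrite big_ord_recr /= bcoefE mform_orth ?mul0r ?addr0; last first.
  by rewrite size_polyXn; lia.
apply: eq_bigr => j _; rewrite adjM adj_mform// bcoefE adj_mxeval_star.
by congr (ip _ 'X^_ * _); lia.
Qed.

End Linking.

(** The analytic input is confined to the hypotheses on the moment sequence and on the norms of the
    P_k. *)
Lemma ode_of_moments (R : realType) (N : nat) (W : R -> 'M[R]_N.+1)
    (S : nat -> 'M[R[i]]_N.+1) (G : {poly 'M[R[i]]_N.+1})
    (P : nat -> {poly 'M[R[i]]_N.+1}) (n : nat) (z : R[i]) :
  (forall k, adj (S k) = S k) -> pearson S G ->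
  (forall p q, mxinner W p q = mform S p q) ->
  (forall p k,
    mxintegral (fun x => (x ^+ k)%:C *: (real_mxeval p x *m cweight W x))
    = mform S p 'X^k) ->
  (forall k, mform S (P k) (P k) \is a GRing.unit) ->
  monic_orthogonal W P ->
  mxeval (calA W P G n) z \in unitmx ->
  mxeval (P n)^`()^`() z
  + (mxeval (P n)^`() z *m mxeval G z) *+ 2
  + mxeval (P n) z *m (mxeval G^`() z + mxeval G z *m mxeval G z)
  + calM W P G n z *m mxeval (P n)^`() z
  + calN W P G n z *m mxeval (P n) z
  + calM W P G n z *m mxeval (P n) z *m mxeval G z = 0.
Proof.
move=> adjS pS innerE momentE uP hP uA.
have evA k x := mxeval_calA_star G adjS innerE momentE hP uP k x.
have evB k x := mxeval_calB G adjS innerE momentE hP uP k x.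
have uAs : mxeval (mxpoly_star (calA W P G n)) z \is a GRing.unit.
  rewrite evA unitrN unitrMl ?unitrV//.
  have : mxeval (calA W P G n) z \is a GRing.unit by exact: uA.
  rewrite (mxeval_calA G adjS innerE momentE hP) unitrN.
  by rewrite unitrMr// unitrV.
case: n uA uAs => [|n] uA uAs.
  (* For n = 0, P_0 = 1, B_0 = - G and the term with A_{-1} is zero; everything cancels whatever the
     value of M_0. *)
  have -> : P 0%N = 1.
    have [mon sz _] := hP 0%N; rewrite [P 0%N]size1_polyC ?sz//.
    by have := monicP mon; rewrite lead_coefE sz => ->.
  have e1 : mxeval (1 : {poly 'M[R[i]]_N.+1}) z = 1 by rewrite -polyC1 mxevalC.
  have d1 : (1 : {poly 'M[R[i]]_N.+1})^`() = 0 by rewrite -polyC1 derivC.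
  rewrite d1 deriv0 !mxeval0 e1 /calN /= derivN !mxevalN.
  rewrite !(mulmx0, mul0mx, mul0rn, mulmx1, mul1mx, mulmxN, mulNmx).
  rewrite !add0r !addr0 opprK.
  by rewrite [LHS](AC (2*3*1) ((1*5)*(2*4)*(6*3)))/= !subrr !addr0.
(* Writing A^*(z - alpha) as A^*(z - alpha) A^* A^{-*} brings M_{n+1} to the form used in
   [ladder_ode]. *)
have calME : calM W P G n.+1 z =
   - (mxeval (mxpoly_star (calA W P G n.+1))^`() z
      * (mxeval (mxpoly_star (calA W P G n.+1)) z)^-1)
    + mxeval (calB W P G n.+1) z + mxeval (mxpoly_star (calA W P G n.+1)) z
      * (mxeval (calB W P G n.+2) z
         - (z%:M - rec_alpha P n.+1) * mxeval (mxpoly_star (calA W P G n.+1)) z)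
      * (mxeval (mxpoly_star (calA W P G n.+1)) z)^-1.
  rewrite /calM (alphaE P) [in RHS]mulrBr [in RHS]mulrBl [in RHS]mulrA mulrK//.
  by rewrite !mulmxE [RHS]addrA [RHS]addrAC.
have := ladder_ode adjS pS (fun n => let: And3 m _ _ := hP n in m)
 (size_monic_orthogonal hP) (mform_orth innerE hP) uP evA evB uAs.
rewrite /calN (betaE P innerE) !calME !mulmxE /=.
exact.
Qed.

(** * Integration and differentiation of matrix functions *)

Section IntegralOfDerivative.
Local Open Scope classical_set_scope.
Context {R : realType}.
Local Notation mu := (@lebesgue_measure R).
Implicit Types (f h : R -> R) (a b x : R).

Lemma integral_segment_derive h h' a b : a < b ->
  (forall x, is_derive x 1 h (h' x)) -> continuous h' ->
  (\int[mu]_(x in `[a, b]) (h' x)%:E = (h b)%:E - (h a)%:E)%E.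
Proof.
move=> ab dh ch'.
have ch : continuous h.
  by move=> x; apply/differentiable_continuous/derivable1_diffP; case: (dh x).
apply: continuous_FTC2 => //.
- exact: continuous_subspaceT.
- split => [x _||].
  + by case: (dh x).
  + exact/cvg_at_right_filter/ch.
  + exact/cvg_at_left_filter/ch.
- by move=> x _; rewrite derive1E; apply: derive_val.
Qed.

(** The fundamental theorem of calculus gives a bound independent of the segment, which serves to
    bound x f(x) at infinity. *)
Lemma variation_le_integral h h' a b : a < b ->
  (forall x, is_derive x 1 h (h' x)) -> continuous h' ->
  mu.-integrable setT (EFin \o h') ->
  `|h b - h a| <= \int[mu]_x `|h' x|.
Proof.
move=> ab dh ch' ih'.
have iab : mu.-integrable `[a, b] (EFin \o h') by exact: integrableS ih'.
have -> : h b - h a = \int[mu]_(x in `[a, b]) h' x.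
  by rewrite /Rintegral (integral_segment_derive ab dh ch').
apply: le_trans (le_normr_Rintegral _ iab) _ => //.
rewrite /Rintegral fine_le//.
- by apply: integrable_fin_num => //; exact: integrable_abse iab.
- by apply: integrable_fin_num => //; exact: integrable_abse ih'.
- apply: ge0_subset_integral => //.
  exact: measurable_int (integrable_abse ih').
Qed.

(* Integrability of [(x f x)'] makes [x f x] bounded, hence [f] vanishes at
   infinity. *)
Lemma integral_derive_eq0 f f' :
  (forall x, is_derive x 1 f (f' x)) -> continuous f' ->
  mu.-integrable setT (EFin \o f') ->
  mu.-integrable setT (fun x => (f x + x * f' x)%:E) ->
  \int[mu]_x f' x = 0.
Proof.
move=> df cf' if' ih'.
pose C := \int[mu]_x `|f x + x * f' x|.
pose u (n : nat) : R := n.+1%:R.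
have u0 n : 0 < u n by [].
have cf : continuous f.
  by move=> x; apply/differentiable_continuous/derivable1_diffP; case: (df x).
have dh x : is_derive x 1 (fun t => t * f t) (f x + x * f' x).
  have := is_deriveM (is_derive_id x 1) (df x).
  by rewrite /GRing.scale/= mulr1 addrC.
have ch' : continuous (fun x => f x + x * f' x).
  by move=> x; apply: cvgD; [exact: cf|apply: cvgM => //; exact: cf'].
have bound1 n : `|f (u n)| <= C / u n.
  rewrite ler_pdivlMr// mulrC -[X in X * _]gtr0_norm// -normrM.
  have := variation_le_integral (u0 n) dh ch' ih'.
  by rewrite mul0r subr0.
have bound2 n : `|f (- u n)| <= C / u n.
  rewrite ler_pdivlMr// mulrC -[X in X * _]gtr0_norm// -normrN -normrM.
  have Nu0 : - u n < 0 by rewrite oppr_lt0.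
  have := variation_le_integral Nu0 dh ch' ih'.
  by rewrite mul0r sub0r normrN.
have to0 : (f (u n) - f (- u n))%:E @[n --> \oo] --> 0%:E.
  apply: cvg_EFin; first exact: nearW.
  apply: norm_cvg0; apply: (@squeeze_cvgr _ _ _ _ (fun=> 0)
    (fun n => (C + C) * harmonic n)).
  - apply: nearW => n; rewrite normr_ge0 /=.
    by rewrite (le_trans (ler_normB _ _))// mulrDl lerD.
  - exact: cvg_cst.
  - by rewrite -[X in _ --> X](mulr0 (C + C)); apply: cvgMr; exact: cvg_harmonic.
pose fn n x := ((f' \_ `[- u n, u n]) x)%:E.
have intfn n : (\int[mu]_x fn n x = (f (u n) - f (- u n))%:E)%E.
  rewrite EFinB -(integral_segment_derive _ df cf') ?gtrN//.
  by rewrite [RHS]integral_mkcond; apply: eq_integral => x _; rewrite /fn restrict_EFin.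
(* Dominated convergence on the growing segments, with dominating function |f'|. *)
have toint : (\int[mu]_x fn n x @[n --> \oo] --> \int[mu]_x (f' x)%:E)%E.
  apply: (@dominated_cvg _ _ _ mu setT _ _ _ (fun x => `|f' x|%:E)) => //.
  - move=> n; apply: (@measurable_int _ _ _ mu).
    rewrite /fn (_ : (fun x => _) = (EFin \o f') \_ `[- u n, u n]).
      by rewrite -integrable_mkcond//; exact: integrableS if'.
    by apply/funext => x; rewrite /= restrict_EFin.
  - move=> x _; apply: cvg_near_cst; near=> n.
    rewrite /fn patchE ifT// inE/= in_itv/= -ler_norml /u.
    rewrite (@le_trans _ _ n%:R) ?ler_nat//.
    by near: n; exact: nbhs_infty_ger.
  - exact: integrable_abse if'.
  - move=> n x _; rewrite /fn patchE; case: ifP => _ //=.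
    by rewrite normr0 lee_fin.
have fnE : (fun n => \int[mu]_x fn n x)%E = (fun n => (f (u n) - f (- u n))%:E).
  exact/funext.
rewrite fnE in toint; have E0 := cvg_unique (@ereal_hausdorff R) toint to0.
by rewrite /Rintegral E0.
Unshelve. all: by end_near.
Qed.

End IntegralOfDerivative.

(** * Integrals of complex and matrix functions *)

Section ComplexIntegral.
Local Open Scope classical_set_scope.
Context {R : realType}.
Local Notation mu := (@lebesgue_measure R).
Implicit Types (f g : R -> R[i]) (u v c : R[i]) (r : R -> R).

(** [cintegral] is total, so linearity requires integrability; the value is carried together with
    the integrability of both parts. *)
Definition has_cintegral f v : Prop :=
  [/\ mu.-integrable setT (EFin \o (fun x => complex.Re (f x))),
      mu.-integrable setT (EFin \o (fun x => complex.Im (f x)))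
    & cintegral f = v].

Lemma has_cintegral_real r : mu.-integrable setT (fun x => (r x)%:E) ->
  has_cintegral (fun x => (r x)%:C) (\int[mu]_x r x)%:C.
Proof.
move=> ir; split=> //=; first exact: integrable0.
by rewrite /cintegral /= Rintegral_cst// mul0r.
Qed.

Lemma has_cintegralD f g u v : has_cintegral f u -> has_cintegral g v ->
  has_cintegral (fun x => f x + g x) (u + v).
Proof.
move=> [rf jf <-] [rg jg <-].
have ReE : (fun x => complex.Re (f x + g x)) =
    fun x => complex.Re (f x) + complex.Re (g x).
  by apply/funext => x; case: (f x) (g x) => a b [].
have ImE : (fun x => complex.Im (f x + g x)) =
    fun x => complex.Im (f x) + complex.Im (g x).
  by apply/funext => x; case: (f x) (g x) => a b [].
split.
- by rewrite ReE; exact: (integrableD measurableT rf rg).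
- by rewrite ImE; exact: (integrableD measurableT jf jg).
- by rewrite /cintegral ReE ImE !RintegralD.
Qed.

Lemma has_cintegralZ c f u : has_cintegral f u ->
  has_cintegral (fun x => c * f x) (c * u).
Proof.
case: c => a b [rf jf <-].
have iZ (k : R) r : mu.-integrable setT (EFin \o r) ->
    mu.-integrable setT (EFin \o (fun x => k * r x)).
  by move=> ir; exact: (integrableZl measurableT k ir).
have ReE : (fun x => complex.Re ((a +i* b) * f x)) =
    fun x => a * complex.Re (f x) - b * complex.Im (f x).
  by apply/funext => x; case: (f x).
have ImE : (fun x => complex.Im ((a +i* b) * f x)) =
    fun x => a * complex.Im (f x) + b * complex.Re (f x).
  by apply/funext => x; case: (f x).
split.
- by rewrite ReE; exact: (integrableB measurableT (iZ a _ rf) (iZ b _ jf)).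
- by rewrite ImE; exact: (integrableD measurableT (iZ a _ jf) (iZ b _ rf)).
- rewrite /cintegral ReE ImE RintegralB ?RintegralD ?RintegralZl//; exact: iZ.
Qed.

Definition has_mxintegral m n (F : R -> 'M[R[i]]_(m, n)) (V : 'M[R[i]]_(m, n)) : Prop :=
  forall i j, has_cintegral (fun x => F x i j) (V i j).

Lemma mxintegralE m n (F : R -> 'M[R[i]]_(m, n)) V :
  has_mxintegral F V -> mxintegral F = V.
Proof. by move=> h; apply/matrixP => i j; rewrite mxE; case: (h i j). Qed.

Lemma has_mxintegral_real m n (F : R -> 'M[R]_(m, n)) :
  (forall i j, mu.-integrable setT (fun x => (F x i j)%:E)) ->
  has_mxintegral (fun x => map_mx (real_complex R) (F x))
    (\matrix_(i, j) (\int[mu]_x F x i j)%:C).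
Proof.
move=> h i j; rewrite mxE; under eq_fun do rewrite mxE.
exact: has_cintegral_real.
Qed.

Lemma has_mxintegralD m n (F1 F2 : R -> 'M[R[i]]_(m, n)) V1 V2 :
  has_mxintegral F1 V1 -> has_mxintegral F2 V2 ->
  has_mxintegral (fun x => F1 x + F2 x) (V1 + V2).
Proof.
move=> h1 h2 i j; rewrite mxE; under eq_fun do rewrite mxE.
exact: has_cintegralD.
Qed.

Lemma has_cintegral_sum I (s : seq I) (F : I -> R -> R[i]) (V : I -> R[i]) :
  (forall i, has_cintegral (F i) (V i)) ->
  has_cintegral (fun x => \sum_(i <- s) F i x) (\sum_(i <- s) V i).
Proof.
move=> h; elim: s => [|i s IH].
  under eq_fun do rewrite big_nil; rewrite big_nil.
  have := has_cintegralZ 0 (@has_cintegral_real (fun=> 0) (integrable0 _ _)).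
  by rewrite !mul0r.
under eq_fun do rewrite big_cons; rewrite big_cons.
exact: has_cintegralD.
Qed.

Lemma has_mxintegral_sum m n I (s : seq I) (F : I -> R -> 'M[R[i]]_(m, n)) V :
  (forall i, has_mxintegral (F i) (V i)) ->
  has_mxintegral (fun x => \sum_(i <- s) F i x) (\sum_(i <- s) V i).
Proof.
move=> h i j; rewrite summxE; under eq_fun do rewrite summxE.
by apply: has_cintegral_sum => k; exact: h.
Qed.

Lemma has_mxintegralMl m n p (A : 'M[R[i]]_(m, n)) (F : R -> 'M[R[i]]_(n, p)) V :
  has_mxintegral F V -> has_mxintegral (fun x => A *m F x) (A *m V).
Proof.
move=> h i j; rewrite mxE; under eq_fun do rewrite mxE.
by apply: has_cintegral_sum => k; exact: has_cintegralZ.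
Qed.

Lemma has_mxintegralMr m n p (A : 'M[R[i]]_(n, p)) (F : R -> 'M[R[i]]_(m, n)) V :
  has_mxintegral F V -> has_mxintegral (fun x => F x *m A) (V *m A).
Proof.
move=> h i j; rewrite mxE; under eq_fun do rewrite mxE.
apply: has_cintegral_sum => k; rewrite mulrC; under eq_fun do rewrite mulrC.
exact: has_cintegralZ.
Qed.

End ComplexIntegral.

(** * Derivatives of complex functions of a real variable *)

Section ComplexDerivative.
Context {R : realType}.
Implicit Types (f g : R -> R[i]) (d e : R[i]) (x : R).

Definition has_cderive f x d : Prop :=
  is_derive x 1 (fun t => complex.Re (f t)) (complex.Re d) /\
  is_derive x 1 (fun t => complex.Im (f t)) (complex.Im d).

Lemma has_cderive_real (r : R -> R) x (a : R) : is_derive x 1 r a ->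
  has_cderive (fun t => (r t)%:C) x a%:C.
Proof. by move=> h; split => //=; exact: is_derive_cst. Qed.

Lemma has_cderive_unique f x d e : has_cderive f x d -> has_cderive f x e -> d = e.
Proof.
case: d e => [a b] [c d] [/= h1 h2] [/= h3 h4]; congr (_ +i* _).
  by rewrite -(@derive_val _ _ _ _ _ _ _ h1) (@derive_val _ _ _ _ _ _ _ h3).
by rewrite -(@derive_val _ _ _ _ _ _ _ h2) (@derive_val _ _ _ _ _ _ _ h4).
Qed.

Lemma has_cderive_conj f x d : has_cderive f x d ->
  has_cderive (fun t => Num.conj (f t)) x (Num.conj d).
Proof.
move=> [h1 h2].
have ReE z : complex.Re (Num.conj z) = complex.Re z :> R by case: z.
have ImE z : complex.Im (Num.conj z) = - complex.Im z :> R by case: z.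
split; first by rewrite ReE; under eq_fun do rewrite ReE.
by rewrite ImE; under eq_fun do rewrite ImE; exact: is_deriveN.
Qed.

Lemma has_cderiveD f g x d e : has_cderive f x d -> has_cderive g x e ->
  has_cderive (fun t => f t + g t) x (d + e).
Proof.
move=> [h1 h2] [h3 h4].
have ReE (y z : R[i]) : complex.Re (y + z) = complex.Re y + complex.Re z.
  by case: y z => ? ? [].
have ImE (y z : R[i]) : complex.Im (y + z) = complex.Im y + complex.Im z.
  by case: y z => ? ? [].
split; first by rewrite ReE; under eq_fun do rewrite ReE; exact: is_deriveD.
by rewrite ImE; under eq_fun do rewrite ImE; exact: is_deriveD.
Qed.

Lemma has_cderiveM f g x d e : has_cderive f x d -> has_cderive g x e ->
  has_cderive (fun t => f t * g t) x (d * g x + f x * e).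
Proof.
move=> [h1 h2] [h3 h4].
have ReE (y z : R[i]) :
    complex.Re (y * z) = complex.Re y * complex.Re z - complex.Im y * complex.Im z.
  by case: y z => ? ? [].
have ImE (y z : R[i]) :
    complex.Im (y * z) = complex.Re y * complex.Im z + complex.Im y * complex.Re z.
  by case: y z => ? ? [].
have ReD (y z : R[i]) : complex.Re (y + z) = complex.Re y + complex.Re z.
  by case: y z => ? ? [].
have ImD (y z : R[i]) : complex.Im (y + z) = complex.Im y + complex.Im z.
  by case: y z => ? ? [].
split.
- rewrite ReD !ReE; under eq_fun do rewrite ReE.
  apply: (is_derive_eq (is_deriveB (is_deriveM h1 h3) (is_deriveM h2 h4))).
  by rewrite /GRing.scale /=; ring.
- rewrite ImD !ImE; under eq_fun do rewrite ImE.
  apply: (is_derive_eq (is_deriveD (is_deriveM h1 h4) (is_deriveM h2 h3))).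
  by rewrite /GRing.scale /=; ring.
Qed.

Lemma has_cderive_sum I (s : seq I) (F : I -> R -> R[i]) (d : I -> R[i]) x :
  (forall i, has_cderive (F i) x (d i)) ->
  has_cderive (fun t => \sum_(i <- s) F i t) x (\sum_(i <- s) d i).
Proof.
move=> h; elim: s => [|i s IH].
  under eq_fun do rewrite big_nil; rewrite big_nil.
  exact: (has_cderive_real (is_derive_cst 0 x 1)).
under eq_fun do rewrite big_cons; rewrite big_cons.
exact: has_cderiveD.
Qed.

End ComplexDerivative.

(** * The relation W' = G W + W G^* *)

Section WeightDerivative.
Context {R : realType} {N : nat}.
Local Notation M := 'M[R[i]]_N.+1.
Context (W : R -> 'M[R]_N.+1) (T : R -> M) (G : {poly M}).
Context (hW : is_weight W) (hT : mx_smooth T).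
Context (hWT : forall x : R, cweight W x = T x *m (T x) ^t* ).
Context (hTG : mx_ode_solution T G).

Definition weight_derive (x : R) : 'M[R]_N.+1 :=
  \matrix_(i, j) derive1 (fun t => W t i j) x.

Lemma smooth_is_derive (f : R -> R) (x : R) : smooth f -> is_derive x 1 f (derive1 f x).
Proof. by move=> sf; rewrite derive1E; apply: derivableP; exact: (sf 0%N x). Qed.

Lemma is_derive_weight i j (x : R) :
  is_derive x 1 (fun t => W t i j) (weight_derive x i j).
Proof. by rewrite mxE; apply: smooth_is_derive; case: hW => h _ _ _; exact: h. Qed.

Lemma continuous_weight_derive i j : continuous (fun x => weight_derive x i j).
Proof.
move=> x; under eq_fun do rewrite mxE.
apply/differentiable_continuous/derivable1_diffP.
by case: hW => h _ _ _; exact: (h i j 1%N x).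
Qed.

Lemma has_cderive_ode i j (x : R) :
  has_cderive (fun t => T t i j) x ((real_mxeval G x *m T x) i j).
Proof.
have [sr si] := hT i j; have [hr hi] := hTG x i j.
by split; [rewrite -hr|rewrite -hi]; exact: smooth_is_derive.
Qed.

(** The product rule is applied entrywise to W = T T^* with T' = G T, and uniqueness of the
    derivative identifies the result with W'. *)
Lemma weight_deriveE (x : R) : map_mx (real_complex R) (weight_derive x) =
  real_mxeval G x *m cweight W x + cweight W x *m adj (real_mxeval G x).
Proof.
apply/matrixP => i j; rewrite mxE.
apply: (has_cderive_unique (has_cderive_real (is_derive_weight i j x))).
have -> : (fun t => (W t i j)%:C) =
    (fun t => \sum_k T t i k * Num.conj (T t j k)).
  apply/funext => t; have := congr1 (fun A : M => A i j) (hWT t).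
  by rewrite !mxE => ->; apply: eq_bigr => k _; rewrite !mxE.
have -> : (real_mxeval G x *m cweight W x + cweight W x *m adj (real_mxeval G x)) i j
  = \sum_k ((real_mxeval G x *m T x) i k * Num.conj (T x j k)
            + T x i k * Num.conj ((real_mxeval G x *m T x) j k)).
  rewrite hWT mulmxA -[X in _ + X]mulmxA -[adj _]/((real_mxeval G x) ^t* ).
  rewrite -map_mxM -trmx_mul big_split /= mxE; congr (_ + _).
    by rewrite mxE; apply: eq_bigr => k _; rewrite !mxE.
  by rewrite mxE; apply: eq_bigr => k _; rewrite [(_ ^t* ) _ _]mxE [(_^T) _ _]mxE.
apply: has_cderive_sum => k.
exact: has_cderiveM (has_cderive_ode _ _ _) (has_cderive_conj (has_cderive_ode _ _ _)).
Qed.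

End WeightDerivative.

(** * Moments of the weight *)

Section Moments.
Local Open Scope classical_set_scope.
Context {R : realType} {N : nat}.
Local Notation M := 'M[R[i]]_N.+1.
Local Notation mu := (@lebesgue_measure R).
Context (W : R -> 'M[R]_N.+1) (hW : is_weight W).
Implicit Types (p q : {poly M}) (x : R).

Definition moment k : M :=
  \matrix_(i, j) (\int[mu]_x (x ^+ k * W x i j))%:C.

Lemma has_moment k :
  has_mxintegral (fun x => (x ^+ k)%:C *: cweight W x) (moment k).
Proof.
have -> : (fun x => (x ^+ k)%:C *: cweight W x) =
    (fun x => map_mx (real_complex R) (x ^+ k *: W x)).
  by apply/funext => x; rewrite map_mxZ.
have -> : moment k = \matrix_(i, j) (\int[mu]_x (x ^+ k *: W x) i j)%:C.
  apply/matrixP => i j; rewrite !mxE; congr (_%:C).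
  by apply: eq_Rintegral => x _; rewrite mxE.
apply: has_mxintegral_real => i j; under eq_fun do rewrite mxE.
by case: hW => _ _ h _; exact: h.
Qed.

Lemma weight_sym x i j : W x i j = W x j i.
Proof.
case: hW => _ /(_ x)[sW _] _ _.
by rewrite -{1}sW mxE.
Qed.

Lemma adj_moment k : adj (moment k) = moment k.
Proof.
apply/matrixP => i j; rewrite !mxE; apply/eqP; rewrite eq_complex /= oppr0 eqxx andbT.
by apply/eqP/eq_Rintegral => x _; rewrite weight_sym.
Qed.

Lemma real_mxevalE p x :
  real_mxeval p x = \sum_(a < size p) (x ^+ a)%:C *: p`_a.
Proof.
rewrite /real_mxeval /mxeval horner_coef; apply: eq_bigr => a _.
by rewrite -rmorphXn /= -[_ * _]/(_ *m _) mul_mx_scalar rmorphXn.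
Qed.

Lemma adj_real_mxeval q x :
  (real_mxeval q x) ^t* = \sum_(b < size q) (x ^+ b)%:C *: adj q`_b.
Proof.
rewrite real_mxevalE -/(adj _) adj_sum; apply: eq_bigr => b _.
apply/matrixP => i j; rewrite !mxE rmorphM /=; congr (_ * _).
by apply/eqP; rewrite eq_complex /= oppr0 !eqxx.
Qed.

Lemma has_mxinner p q :
  has_mxintegral (fun x => real_mxeval p x *m cweight W x *m (real_mxeval q x) ^t* )
    (mform moment p q).
Proof.
have -> : (fun x => real_mxeval p x *m cweight W x *m (real_mxeval q x) ^t* ) =
    (fun x => \sum_(a < size p) \sum_(b < size q)
       p`_a *m ((x ^+ (a + b))%:C *: cweight W x) *m adj q`_b).
  apply/funext => x; rewrite adj_real_mxeval real_mxevalE !mulmx_suml.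
  apply: eq_bigr => a _; rewrite mulmx_sumr; apply: eq_bigr => b _.
  rewrite -!scalemxAl -!scalemxAr -scalemxAl scalerA; congr (_ *: _).
  by rewrite exprD rmorphM /= mulrC.
apply: has_mxintegral_sum => a; apply: has_mxintegral_sum => b.
by apply/has_mxintegralMr/has_mxintegralMl/has_moment.
Qed.

Lemma mxinnerE p q : mxinner W p q = mform moment p q.
Proof. exact/mxintegralE/has_mxinner. Qed.

Lemma mxintegral_momentE p k :
  mxintegral (fun x => (x ^+ k)%:C *: (real_mxeval p x *m cweight W x))
  = mform moment p 'X^k.
Proof.
rewrite -mxinnerE /mxinner; congr (mxintegral _); apply/funext => x.
have -> : (real_mxeval ('X^k : {poly M}) x) ^t* = ((x ^+ k)%:C)%:M.
  rewrite adj_real_mxeval size_polyXn big_ord_recr /= big1 ?add0r.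
    by rewrite coefXn eqxx adj1 scale_scalar_mx mulr1.
  by move=> b _; rewrite coefXn ltn_eqF// adj0 scaler0.
by rewrite mul_mx_scalar.
Qed.

Section Pearson.
Context (T : R -> M) (G : {poly M}) (hT : mx_smooth T).
Context (hWT : forall x : R, cweight W x = T x *m (T x) ^t* ).
Context (hTG : mx_ode_solution T G).

Lemma integrable_moment k i j :
  mu.-integrable setT (EFin \o (fun x => x ^+ k * W x i j)).
Proof. by case: hW => _ _ h _; exact: h. Qed.

Lemma integrable_derive_moment k i j :
  mu.-integrable setT (EFin \o (fun x => x ^+ k * weight_derive W x i j)).
Proof.
case: hW => _ _ _ h; have := h i j k; congr (mu.-integrable setT _).
by apply/funext => x; rewrite /= mxE.
Qed.

(** [integral_derive_eq0] applied to x^k W_ij; the finite moments of W and W' supply the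
    integrability. *)
Lemma integral_moment_derive k i j :
  (\int[mu]_x (x ^+ k.-1 * W x i j)) *+ k
  + \int[mu]_x (x ^+ k * weight_derive W x i j) = 0.
Proof.
pose w x := W x i j; pose dw x := weight_derive W x i j.
have dW x : is_derive x 1 w (dw x) by exact: is_derive_weight.
have cw : continuous w.
  by move=> x; apply/differentiable_continuous/derivable1_diffP; case: (dW x).
have cdw : continuous dw by exact: continuous_weight_derive.
have cX m : continuous (fun x : R => x ^+ m) by exact: exprn_continuous.
have ikw : mu.-integrable setT (EFin \o (fun x => k%:R * (x ^+ k.-1 * w x))).
  exact: (integrableZl measurableT k%:R (integrable_moment k.-1 i j)).
have idw m : mu.-integrable setT (EFin \o (fun x => x ^+ m * dw x)).
  exact: integrable_derive_moment.
have <- : \int[mu]_x (k%:R * (x ^+ k.-1 * w x) + x ^+ k * dw x) = 0.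
  apply: (integral_derive_eq0 (f := fun x => x ^+ k * w x)).
  - move=> x; have dX : is_derive x 1 (fun t : R => t ^+ k) (x ^+ k.-1 *+ k).
      have -> : (fun t : R => t ^+ k) = (id : R -> R) ^+ k.
        by apply/funext => t; rewrite exprfctE.
      apply: (is_derive_eq (is_deriveX k (is_derive_id x 1))).
      by rewrite /GRing.scale /= mulr1 mulr_natl.
    apply: (is_derive_eq (is_deriveM dX (dW x))).
    by rewrite /GRing.scale /= addrC -mulr_natl; congr (_ + _); ring.
  - move=> x; apply: cvgD; last by apply: cvgM; [exact: cX|exact: cdw].
    by apply: cvgM; [exact: cvg_cst|apply: cvgM; [exact: cX|exact: cw]].
  - exact: (integrableD measurableT ikw (idw k)).
  (* For f = x^k w, the function f + x f' is (k + 1) x^k w + x^{k+1} w'. *)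
  - have i1 : mu.-integrable setT (EFin \o (fun x => k.+1%:R * (x ^+ k * w x))).
      exact: (integrableZl measurableT k.+1%:R (integrable_moment k i j)).
    have := integrableD measurableT i1 (idw k.+1); congr (mu.-integrable setT _).
    apply/funext => x /=; rewrite -EFinD; congr (_%:E).
    by case: k {ikw idw i1} => [|k] /=; rewrite !exprS; ring.
rewrite RintegralD// RintegralZl ?mulr_natl//; exact: integrable_moment.
Qed.

(** The k-th moment of W' is computed twice: entrywise by parts, and by substituting W' = G W + W
    G^*. *)
Lemma pearson_moment : pearson moment G.
Proof.
move=> k; pose V : M :=
  \matrix_(i, j) (\int[mu]_x (x ^+ k *: weight_derive W x) i j)%:C.
have hV : has_mxintegral
    (fun x => map_mx (real_complex R) (x ^+ k *: weight_derive W x)) V.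
  apply: has_mxintegral_real => i j; under eq_fun do rewrite mxE.
  exact: integrable_derive_moment.
have -> : \sum_(l < size G) (G`_l * moment (k + l) + moment (k + l) * adj G`_l) = V.
  rewrite -(mxintegralE hV); apply/esym/mxintegralE.
  have -> : (fun x => map_mx (real_complex R) (x ^+ k *: weight_derive W x)) =
      (fun x => \sum_(l < size G) (G`_l *m ((x ^+ (k + l))%:C *: cweight W x)
                 + ((x ^+ (k + l))%:C *: cweight W x) *m adj G`_l)).
    apply/funext => x; rewrite map_mxZ (weight_deriveE hW hT hWT hTG).
    rewrite /adj adj_real_mxeval real_mxevalE big_split /= scalerDr mulmx_suml.
    rewrite mulmx_sumr !scaler_sumr; congr (_ + _); apply: eq_bigr => l _.
      rewrite -scalemxAl -scalemxAr scalerA; congr (_ *: _).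
      by rewrite exprD rmorphM.
    rewrite -scalemxAl -scalemxAr scalerA; congr (_ *: _).
    by rewrite exprD rmorphM.
  apply: has_mxintegral_sum => l; apply: has_mxintegralD.
    exact/has_mxintegralMl/has_moment.
  exact/has_mxintegralMr/has_moment.
apply/matrixP => i j; rewrite !mxE mulmxnE mxE -rmorphMn /= -rmorphD /=.
rewrite -[RHS](rmorph0 (real_complex R)); congr (_%:C).
rewrite -(integral_moment_derive k i j); congr (_ + _).
by apply: eq_Rintegral => x _; rewrite mxE.
Qed.

End Pearson.
End Moments.

(** * Invertibility of the norms, from positivity of the weight *)

Section Positivity.
Local Open Scope classical_set_scope.
Context {R : realType} {N : nat}.
Local Notation M := 'M[R[i]]_N.+1.
Local Notation mu := (@lebesgue_measure R).
Context (W : R -> 'M[R]_N.+1) (hW : is_weight W).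

(** With y = a + i b and A real, the cross terms are purely imaginary, and the real part is a A a^T
    + b A b^T. *)
Lemma Re_posdef (A : 'M[R]_N.+1) (y : 'rV[R[i]]_N.+1) :
  posdefmx A -> 0 <= complex.Re ((y *m map_mx (real_complex R) A *m y ^t* ) 0 0)
    ?= iff (y == 0).
Proof.
move=> [_ pA]; pose a : 'rV[R]_N.+1 := map_mx (@complex.Re R) y.
pose b : 'rV[R]_N.+1 := map_mx (@complex.Im R) y.
have ReD (u v : R[i]) : complex.Re (u + v) = complex.Re u + complex.Re v.
  by case: u v => ? ? [].
have Re_sum I (s : seq I) (F : I -> R[i]) :
    complex.Re (\sum_(i <- s) F i) = \sum_(i <- s) complex.Re (F i).
  exact: (big_morph _ ReD).
have -> : complex.Re ((y *m map_mx (real_complex R) A *m y ^t* ) 0 0) =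
    (a *m A *m a^T) 0 0 + (b *m A *m b^T) 0 0.
  rewrite !mxE Re_sum -big_split /=; apply: eq_bigr => j _.
  rewrite !mxE !mulr_suml Re_sum -big_split /=; apply: eq_bigr => k _.
  by rewrite !mxE; case: (y 0 k) (y 0 j) => [? ?] [? ?] /=; ring.
have pos (v : 'rV[R]_N.+1) : 0 <= (v *m A *m v^T) 0 0.
  have [->|v0] := eqVneq v 0; first by rewrite !mul0mx mxE.
  exact/ltW/pA.
have yab : (y == 0) = (a == 0) && (b == 0).
  apply/eqP/andP => [y0|[/eqP a0 /eqP b0]].
    by split; apply/eqP/matrixP => i j; rewrite !mxE y0 mxE.
  apply/matrixP => i j; rewrite [RHS]mxE; apply/eqP; rewrite eq_complex /=.
  have := congr1 (fun v : 'rV[R]_N.+1 => v i j) a0.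
  have := congr1 (fun v : 'rV[R]_N.+1 => v i j) b0.
  by rewrite !mxE => -> ->; rewrite eqxx.
split; first exact: addr_ge0.
rewrite yab eq_sym paddr_eq0//; congr (_ && _).
  have [->|v0] := eqVneq a 0; first by rewrite !mul0mx mxE eqxx.
  by apply/negbTE; rewrite gt_eqF ?pA.
have [->|v0] := eqVneq b 0; first by rewrite !mul0mx mxE eqxx.
by apply/negbTE; rewrite gt_eqF ?pA.
Qed.

(** A real root is the real part of one of the finitely many complex roots, and finite sets have
    measure zero. *)
Lemma negligible_real_roots (s : {poly R[i]}) : s != 0 ->
  mu.-negligible [set x : R | root s x%:C].
Proof.
move=> s0; have [rs sE] := closed_field_poly_normal s.
apply: (@negligibleS _ _ _ mu [set` [seq complex.Re c | c <- rs]]).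
  move=> x /=; rewrite sE rootZ ?lead_coef_eq0// root_prod_XsubC => h.
  by apply/mapP; exists x%:C.
have fin := finite_set_countable (finite_seq [seq complex.Re c | c <- rs]).
apply/negligibleP; last exact: countable_lebesgue_measure0.
by apply: countable_measurable => // x; exact: measurable_set1.
Qed.

(** A nonzero row v in the kernel would make the nonnegative function v p W (v p)^* integrate to 0,
    so that v p(x) = 0 almost everywhere; but some entry of v p is a nonzero polynomial. *)
Lemma mform_monic_unit (p : {poly M}) : p \is monic ->
  mform (moment W) p p \is a GRing.unit.
Proof.
move=> mp; rewrite -[_ \is a GRing.unit]/(_ \in unitmx) unitmxE unitfE.
apply/negP => /det0P[v v0 vH].
pose y x := v *m real_mxeval p x.
pose phi x := complex.Re ((y x *m cweight W x *m (y x) ^t* ) 0 0).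
have phi_ge0 x : 0 <= phi x ?= iff (y x == 0).
  by apply: Re_posdef; case: hW => _ h _ _; exact: h.
have [iphi _ ephi] :=
  has_mxintegralMr (v ^t* ) (has_mxintegralMl v (has_mxinner hW p p)) 0 0.
have phiE : (fun x => complex.Re ((v *m (real_mxeval p x *m cweight W x
    *m (real_mxeval p x) ^t* ) *m v ^t* ) 0 0)) = phi.
  by apply/funext => x; rewrite /phi /y trmx_mul map_mxM !mulmxA.
rewrite phiE in iphi.
have phi0 : (\int[mu]_x (phi x)%:E = 0)%E.
  move/(congr1 (@complex.Re R)): ephi; rewrite vH mul0mx mxE /= phiE => e.
  by rewrite -[LHS]fineK ?integrable_fin_num//; congr (_%:E).
have ae0 : ae_eq mu setT (EFin \o phi) (cst 0%E).
  apply/(ae_eq_integral_abs mu measurableT (measurable_int _ iphi)).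
  rewrite -[RHS]phi0; apply: eq_integral => x _ /=.
  by rewrite ger0_norm//; case: (phi_ge0 x).
have [j vj] : exists j, v 0 j != 0 by exact/rV0Pn.
pose s := \poly_(k < size p) ((v *m p`_k) 0 j).
have sE x : s.[x%:C] = y x 0 j.
  rewrite /s horner_poly /y real_mxevalE mulmx_sumr summxE.
  by apply: eq_bigr => k _; rewrite -scalemxAr [RHS]mxE mulrC rmorphXn.
(* As p is monic, the top coefficient of s is v_j, nonzero by the choice of j. *)
have s0 : s != 0.
  apply: contraNneq vj => s0; have := congr1 (fun q : {poly R[i]} => q`_(size p).-1) s0.
  rewrite coef_poly coef0 prednK ?lt0n ?size_poly_eq0 ?monic_neq0// leqnn.
  by have := monicP mp; rewrite lead_coefE => ->; rewrite mulmx1 => ->.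
(* Where phi vanishes, so does v p(x), and x is a root of s. The whole line would then be
   negligible, whereas [0, 1] has measure 1. *)
have neg : mu.-negligible (setT : set R).
  apply: negligibleS (negligibleU ae0 (negligible_real_roots s0)) => x _.
  have [y0|yn0] := eqVneq (y x) 0.
    by right; rewrite /= /root sE y0 mxE.
  left => /= /(_ I) [px0]; case: (phi_ge0 x) => _ /esym.
  by rewrite (negbTE yn0) px0 eqxx.
have : mu `[0%R, 1%R] = 0%E.
  apply: measure_negligible; first exact: measurable_itv.
  exact: negligibleS neg.
by rewrite lebesgue_measure_itv /= lte_fin ltr01 sube0 => -[] /eqP; rewrite oner_eq0.
Qed.

End Positivity.

(** * The differential equation for W = T T^* *)

Theorem proposition3p10 (R : realType) (N : nat)
    (W : R -> 'M[R]_N.+1) (T : R -> 'M[R[i]]_N.+1)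
    (G : {poly 'M[R[i]]_N.+1}) (P : nat -> {poly 'M[R[i]]_N.+1})
    (hW : is_weight W)
    (hT : mx_smooth T)
    (hWT : forall x : R, cweight W x = T x *m (T x) ^t*)
    (hTG : mx_ode_solution T G)
    (hP : monic_orthogonal W P)
    (n : nat) (z : R[i])
    (hA : mxeval (calA W P G n) z \in unitmx) :
  mxeval (P n)^`()^`() z
  + (mxeval (P n)^`() z *m mxeval G z) *+ 2
  + mxeval (P n) z *m (mxeval G^`() z + mxeval G z *m mxeval G z)
  + calM W P G n z *m mxeval (P n)^`() z
  + calN W P G n z *m mxeval (P n) z
  + calM W P G n z *m mxeval (P n) z *m mxeval G z = 0.
Proof.
apply: (@ode_of_moments _ _ _ (moment W)) => //.
- exact: adj_moment.
- exact: pearson_moment hTG.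
- exact: mxinnerE.
- exact: mxintegral_momentE.
- by move=> k; apply: mform_monic_unit => //; case: (hP k).
Qed.
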